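(* Let $q$ be a prime power, $n \geq 5$, and let $S \subset \mathbb{F}_q^n$ with $|S| > q^4$. Let $\tau > 0$ and $\delta \in (0,1)$ be such that $q \geq 32\max(n(1+\tau)/(\tau\delta)^2,\, n)$. Let $4 \leq r \leq n-1$ be the integer with $q^r < |S| \leq q^{r+1}$ and let $k = n - r + 3$. Then at least a $(1-\delta)$-fraction of all subspaces in $\mathcal{L}_k^*(\mathbb{F}_q^n)$ are $\tau$-shift-balanced with respect to $S$.
   Context: For $1 \le k \le n$, $\mathcal{L}_k(\mathbb{F}_q^n)$ denotes the set of $k$-dimensional affine subspaces ($k$-flats) of $\mathbb{F}_q^n$ and $\mathcal{L}_k^*(\mathbb{F}_q^n)$ the set of $k$-dimensional linear subspaces. For $S \subset \mathbb{F}_q^n$, $E_k(S) = |S|/q^{n-k}$. A flat $R \in \mathcal{L}_k(\mathbb{F}_q^n)$ is $\tau$-balanced with respect to $S$ if $\big||R \cap S| - E_k(S)\big| \leq \tau E_k(S)$, and $\tau$-unbalanced otherwise. A subspace $A \in \mathcal{L}_k^*(\mathbb{F}_q^n)$ is $\tau$-shift-balanced with respect to $S$ if for every $a \in \mathbb{F}_q^n$ the flat $A + a$ is $\tau$-balanced with respect to $S$. *)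

(* Defs.v *)
From HB Require Import structures.
From mathcomp Require Import all_boot all_order all_algebra all_field.
From mathcomp Require Import all_classical all_reals.
Unset Printing Implicit Defensive.
Import Order.TTheory GRing.Theory Num.Theory.
Local Open Scope ring_scope.

(* L_k^*(F^n): the k-dimensional linear subspaces, each given as its set of
   vectors: the row spaces of the rank-k matrices of size k x n. *)
Definition lin_subspaces (F : finFieldType) (n k : nat) : {set {set 'rV[F]_n}} :=
  [set [set v : 'rV[F]_n | (v <= M)%MS] | M in [set M : 'M[F]_(k, n) | \rank M == k]].

Definition shift_flat (F : finFieldType) (n : nat) (A : {set 'rV[F]_n}) (a : 'rV[F]_n)
  : {set 'rV[F]_n} := [set v + a | v in A].

Definition Ek (R : realType) (F : finFieldType) (n k : nat) (S : {set 'rV[F]_n}) : R :=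
  #|S|%:R / (#|F|%:R ^+ (n - k)).

Definition balanced (R : realType) (F : finFieldType) (n k : nat) (tau : R)
  (S Rf : {set 'rV[F]_n}) : Prop :=
  `| #|Rf :&: S|%:R - Ek R F n k S | <= tau * Ek R F n k S.

Definition shift_balanced (R : realType) (F : finFieldType) (n k : nat) (tau : R)
  (S A : {set 'rV[F]_n}) : Prop :=
  forall a : 'rV[F]_n, balanced R F n k tau S (shift_flat F n A a).

(* Main.v *)
Require Import Defs.
From HB Require Import structures.
From mathcomp Require Import all_boot all_order all_algebra all_field.
From mathcomp Require Import all_classical all_reals.
From mathcomp Require Import zify ring lra.
Import Order.TTheory GRing.Theory Num.Theory.
Local Open Scope ring_scope.

(** Put q = |F|, m = r - 1 and E = |S| / q^m > q, and project F^n onto F^m by a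
    random matrix P of full rank.  By pairwise independence the set U_P of points
    whose fibre in S has size far from E is small on average.  If A is not
    shift-balanced, some translate of A meets S in an atypical number of points;
    when P maps A onto the plane spanned by Y, the same second moment bound inside
    this translate shows that most points of a translate of that plane lie in U_P.
    So if too many A were unbalanced, every Y would, with probability at least
    delta / 2 over P, be the direction of a plane nearly contained in U_P.  A greedy
    choice of several P produces a set U, of density at most 1/5, nearly containing
    a translate of the plane spanned by Y for half of all pairs Y.

    This contradicts a Kakeya bound for planes, obtained by the method of
    multiplicities.  A polynomial f vanishing to high order on U is restricted to a
    plane parametrised as a curve of degree q over F(X): the restriction has degree
    q deg f but more zeros with multiplicity on the q^2 points of the plane, so it is 0.
    Applied to the Hasse derivatives of f, this shows that the leading form of f
    vanishes to high order at v - w u for the directions (u, v), where w = X.  These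
    points fill half of a grid of side q^2, which is more than the multiplicity
    Schwartz-Zippel lemma allows. *)

(** * Hasse derivatives and zeros with multiplicity *)

(** The powers of distinct linear factors are pairwise coprime, so their product divides [h];
    compare degrees. *)
Lemma sum_root_mult_lt (L : fieldType) (T : finType) (t : T -> L) (h : {poly L})
    (mu : T -> nat) : injective t -> h != 0 ->
  (forall x, ('X - (t x)%:P) ^+ mu x %| h) -> (\sum_x mu x < size h)%N.
Proof.
move=> t_inj h0 dv.
have dvs (s : seq T) : uniq s -> \prod_(x <- s) ('X - (t x)%:P) ^+ mu x %| h.
  elim: s => [|x s IHs] /=; first by rewrite big_nil dvd1p.
  case/andP=> xs us; rewrite big_cons Gauss_dvdp ?dv ?IHs //.
  apply: coprimep_expl; rewrite coprimep_sym coprimep_XsubC rootE horner_prod.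
  rewrite prodf_seq_neq0; apply/allP => y ys /=.
  rewrite horner_exp hornerXsubC expf_eq0 subr_eq0 negb_and; apply/orP; right.
  by apply: contraNneq xs => /t_inj ->.
have := dvs _ (index_enum_uniq T); move/(dvdp_leq h0); rewrite size_prod; last first.
  by move=> x _; rewrite expf_neq0 // polyXsubC_eq0.
under eq_bigr do rewrite size_exp_XsubC -addn1.
by rewrite big_split /= sum1_card -addSn addnK.
Qed.

(** Taylor expansion at [x], obtained by evaluating [h], seen over the ring of polynomials, at
    [x + (X - x)]: only terms of order at least [k] survive. *)
Lemma nderivn_eq0_dvdp (L : fieldType) (h : {poly L}) (x : L) (k : nat) :
  (forall i, (i < k)%N -> h^`N(i).[x] = 0) -> ('X - x%:P) ^+ k %| h.
Proof.
move=> h0; have -> : h = (map_poly polyC h).[x%:P + ('X - x%:P)].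
  by rewrite addrC subrK -[LHS]comp_polyXr.
rewrite nderiv_taylor; last exact: mulrC.
apply: (big_ind (fun p => ('X - x%:P) ^+ k %| p)); rewrite ?dvdp0 //.
  exact: dvdp_add.
move=> i _; rewrite nderivn_map horner_map /=.
case: (ltnP i k) => ik; first by rewrite h0 // polyC0 mul0r dvdp0.
by rewrite dvdp_mull // dvdp_exp2l.
Qed.

(* The Hasse derivative of order b at x of the polynomial with monomials e i and
   coefficients c i, i in J; iterated ordinary derivatives would lose information in
   positive characteristic. *)
Definition hasse (A : comNzRingType) (I : finType) (J : {set I}) (c : I -> A)
    (e : I -> nat -> nat) (m : nat) (b : nat -> nat) (x : nat -> A) : A :=
  \sum_(i in J) c i * \prod_(j < m) (x j ^+ (e i j - b j) *+ 'C(e i j, b j)).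

(** Points, exponents and orders of derivation are all functions on [nat] of which only the first
    [m] values matter; removing a variable is then a mere shift of the index. *)
Definition point (L : fieldType) (T : finType) (t : T -> L) (v : seq T) (j : nat) : L :=
  nth 0 (map t v) j.

Lemma sum_tuple_cons (T : finType) (m : nat) (G : m.+1.-tuple T -> nat) :
  (\sum_v G v = \sum_(v : m.-tuple T) \sum_x G [tuple of x :: v])%N.
Proof.
rewrite pair_bigA /=.
rewrite (reindex (fun p : m.-tuple T * T => [tuple of p.2 :: p.1])) //=.
exists (fun v => (behead_tuple v, thead v)) => [[v x] _ | v _] /=.
  by congr (_, _); apply/val_inj.
by rewrite [RHS]tuple_eta; apply/val_inj.
Qed.

Lemma nderivn_neq0_mult (L : fieldType) (h : {poly L}) : h != 0 -> forall x : L,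
  exists mu, h^`N(mu).[x] != 0 /\ ('X - x%:P) ^+ mu %| h.
Proof.
move=> h0 x.
have ex : exists mu, h^`N(mu).[x] != 0.
  apply: contrapT => /forallNP nex.
  have : ('X - x%:P) ^+ (size h) %| h.
    by apply: nderivn_eq0_dvdp => i _; apply/eqP; apply/negPn/negP/nex.
  by move/(dvdp_leq h0); rewrite size_exp_XsubC ltnn.
exists (ex_minn ex); case: ex_minnP => mu mu0 min; split=> //.
apply: nderivn_eq0_dvdp => i imu; apply/eqP; apply: contraTT imu => /min.
by rewrite -leqNgt.
Qed.

(** Here [w v] bounds the multiplicity at [v] from above, as witnessed by a nonzero derivative of
    order at most [w v]. Induction on the number of variables: the leading coefficient in the first
    variable has degree at most [d - k], and above each point [v] of the smaller grid a nonzero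
    univariate polynomial of degree [k] has roots of total multiplicity at most [k]. *)
Lemma schwartz_zippel_mult (L : fieldType) (T : finType) (t : T -> L) (I : finType)
    (c : I -> L) (m : nat) : injective t ->
  forall (e : I -> nat -> nat) (J : {set I}) (d : nat),
  (exists i, i \in J) -> {in J, forall i, c i != 0} ->
  {in J &, forall i i', (forall j, (j < m)%N -> e i j = e i' j) -> i = i'} ->
  {in J, forall i, \sum_(j < m) e i j <= d}%N ->
  exists2 w : m.-tuple T -> nat,
    forall v, exists2 b : nat -> nat, (\sum_(j < m) b j <= w v)%N &
      hasse L I J c e m b (point L T t v) != 0
    & (\sum_v w v * #|T| <= d * #|T| ^ m)%N.
Proof.
move=> t_inj; elim: m => [|m IHm] e J d [i0 i0J] cJ eJ dJ.
  (* With no variables all exponent vectors agree, so the polynomial is a single nonzero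
     constant. *)
  have J1 : J = [set i0].
    apply/setP=> i; rewrite inE; apply/idP/eqP => [iJ|->//].
    by apply: eJ.
  exists (fun=> 0%N) => [v|]; last by rewrite big1.
  exists (fun=> 0%N); first by rewrite big_ord0.
  by rewrite /hasse J1 big_set1 big_ord0 mulr1 cJ.
pose k := \max_(i in J) e i 0%N.
have kJ i : i \in J -> (e i 0 <= k)%N by move=> iJ; rewrite /k (bigD1 i) //= leq_maxl.
have [i1 i1J i1k] : {i1 | i1 \in J & k = e i1 0%N}.
  by apply: eq_bigmax_cond; apply/card_gt0P; exists i0.
have kd : (k <= d)%N.
  by apply: leq_trans (dJ _ i1J); rewrite big_ord_recl i1k leq_addr.
pose e' i j := e i j.+1.
pose J' := [set i in J | e i 0%N == k].
have [||||w' w'P w'd] := IHm e' J' (d - k)%N.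
- by exists i1; rewrite inE i1J i1k eqxx.
- by move=> i; rewrite inE => /andP[iJ _]; apply: cJ.
- move=> i i'; rewrite !inE => /andP[iJ /eqP ik] /andP[iJ' /eqP ik'] ee.
  by apply: eJ => // -[|j] jm; [rewrite ik ik' | apply: ee].
- move=> i; rewrite inE => /andP[iJ /eqP ik].
  by have := dJ _ iJ; rewrite big_ord_recl /= ik leq_subRL.
have /choice[b' b'P] : forall v, exists b : nat -> nat,
    (\sum_(j < m) b j <= w' v)%N /\ hasse L I J' c e' m b (point L T t v) != 0.
  by move=> v; have [b b1 b2] := w'P v; exists b.
(* Differentiate in the other variables to order [b' v] and put them equal to [v]. What remains is
   [h v], a polynomial in the first variable whose coefficient of degree [k] is the nonzero
   derivative supplied by the induction. *)
pose C (v : m.-tuple T) i := c i * \prod_(j < m) (point L T t v j ^+ (e' i j - b' v j) *+ 'C(e' i j, b' v j)).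
pose h (v : m.-tuple T) := \sum_(i in J) C v i *: 'X^(e i 0%N).
have hk v : (h v)`_k = hasse L I J' c e' m (b' v) (point L T t v).
  rewrite /h coef_sum /hasse big_mkcond [RHS]big_mkcond /=; apply: eq_bigr => i _.
  rewrite inE; case: (i \in J) => //=; rewrite coefZ coefXn eq_sym.
  by case: eqP => _; rewrite ?mulr1 ?mulr0.
have h0 v : h v != 0.
  have [_] := b'P v; apply: contraNneq => hv0; by rewrite -hk hv0 coef0.
have sh v : (size (h v) <= k.+1)%N.
  apply: (leq_trans (size_sum _ _ _)); apply/bigmax_leqP => i iJ.
  by apply: (leq_trans (size_scale_leq _ _)); rewrite size_polyXn ltnS kJ.
have [mu muP] := choice (fun vx : m.-tuple T * T => nderivn_neq0_mult L (h vx.1) (h0 vx.1) (t vx.2)).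
exists (fun v : m.+1.-tuple T => (w' (behead_tuple v) + mu (behead_tuple v, thead v))%N) => [v|].
  case/tupleP: v => x u; rewrite theadE.
  have -> : behead_tuple [tuple of x :: u] = u by apply/val_inj.
  exists (fun j => if j is j'.+1 then b' u j' else mu (u, x)).
    by rewrite big_ord_recl /= addnC leq_add2r; case: (b'P u).
  have [+ _] := muP (u, x) => /=.
  suff -> : (h u)^`N(mu (u, x)).[t x] = hasse L I J c e m.+1
     (fun j : nat => if j is j'.+1 then b' u j' else mu (u, x))
     (point L T t [tuple of x :: u]) by [].
  rewrite /h raddf_sum horner_sum; apply: eq_bigr => i iJ.
  rewrite [X in X.[_] = _]nderivnZ hornerZ nderivnXn hornerMn hornerXn big_ord_recl /= /C -mulrA.
  by congr (_ * _); rewrite mulrC; congr (_ * _).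
rewrite sum_tuple_cons.
have muk v : (\sum_x mu (v, x) <= k)%N.
  rewrite -ltnS; apply: leq_trans (sh v).
  by apply: (@sum_root_mult_lt L T t) => // x; case: (muP (v, x)).
apply: (@leq_trans (\sum_(v : m.-tuple T) (w' v * #|T| * #|T| + k * #|T|))%N).
  apply: leq_sum => v _.
  rewrite -big_distrl /= -mulnDl leq_mul2r; apply/orP; right.
  rewrite (eq_bigr (fun x => w' v + mu (v, x))%N) => [|x _]; last first.
    by rewrite theadE; congr (w' _ + mu (_, _))%N; apply/val_inj.
  by rewrite big_split /= sum_nat_const mulnC leq_add2l.
rewrite big_split /= -big_distrl /= sum_nat_const card_tuple expnS.
apply: leq_trans (leq_add (leq_mul w'd (leqnn #|T|)) (leqnn _)) _.
rewrite -{2}(subnK kd); move: (d - k)%N (#|T| ^ m)%N #|T| => a Q q; nia.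
Qed.

(** * Taylor expansion along a curve *)

Lemma bin_mul_bin (a g b : nat) :
  ('C(a, g) * 'C(a - g, b) = 'C(a, g + b) * 'C(g + b, g))%N.
Proof.
have [gba | gba] := leqP (g + b) a; last first.
  rewrite (bin_small gba) mul0n; have [ga|ga] := leqP g a.
    by rewrite [X in (_ * X)%N]bin_small ?muln0 // ltn_subLR.
  by rewrite bin_small.
have ga : (g <= a)%N := leq_trans (leq_addr _ _) gba.
have b_ag : (b <= a - g)%N by rewrite leq_subRL.
have E1 := bin_fact ga; have E2 := bin_fact b_ag; have E3 := bin_fact gba.
have := bin_fact (leq_addr b g); rewrite addKn => E4.
rewrite -E1 -E2 -E4 subnDA in E3.
have p : (0 < g`! * b`! * (a - g - b)`!)%N by rewrite !muln_gt0 !fact_gt0.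
apply/eqP; rewrite -(eqn_pmul2r p); apply/eqP.
by move: E3; lia.
Qed.

(** The range [N] does not depend on the exponent [a], so that the expansions of all monomials can
    be summed together; the excess terms have a zero binomial coefficient. *)
Lemma taylor_monomial (A : comNzRingType) (x z : A) (a g N : nat) : (a < N)%N ->
  (x + z) ^+ (a - g) *+ 'C(a, g) =
  \sum_(b < N) (x ^+ (a - (g + b)) *+ 'C(a, g + b)) * (z ^+ b *+ 'C(g + b, g)).
Proof.
move=> aN; rewrite exprDn -sumrMnl.
have le : (((a - g).+1 <= N))%N by rewrite (leq_trans _ aN) // ltnS leq_subr.
rewrite (big_ord_widen _ (fun b : nat => (x ^+ (a - g - b) * z ^+ b *+ 'C(a - g, b)) *+ 'C(a, g)) le).
rewrite big_mkcond; apply: eq_bigr => b _.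
rewrite mulrnAl mulrnAr -!mulrnA [in RHS]mulnC -bin_mul_bin subnDA.
case: ltnP => [_|ab]; first by rewrite mulnC.
by rewrite [X in (_ * X)%N]bin_small // muln0 mulr0n.
Qed.

(** Expand the derivative of order [g] at [x] in powers of [P j - x j], each divisible by [X - s].
    The term of index [b] has as coefficient a derivative of order [g + b] at [x]: either this order
    is below [M] and the coefficient vanishes, or [b] has weight at least [M] minus that of [g]. *)
Lemma hasse_curve_dvdp (L : fieldType) (I : finType) (J : {set I}) (c : I -> L)
    (e : I -> nat -> nat) (m : nat) (g : nat -> nat) (x : nat -> L)
    (P : nat -> {poly L}) (s : L) (M : nat) :
  (forall b : nat -> nat, (\sum_(j < m) b j < M)%N -> hasse L I J c e m b x = 0) ->
  (forall j, (j < m)%N -> 'X - s%:P %| P j - (x j)%:P) ->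
  ('X - s%:P) ^+ (M - \sum_(j < m) g j)
    %| hasse {poly L} I J (fun i => (c i)%:P) e m g P.
Proof.
move=> x0 Pd; set N := (\max_(i in J) \max_(j < m) e i j).+1.
have eN i (j : 'I_m) : i \in J -> (e i j < N)%N.
  move=> iJ; rewrite ltnS; apply: leq_trans (@leq_bigmax_cond _ _ (fun i => \max_(j < m) e i j) _ iJ).
  exact: (@leq_bigmax _ (fun j : 'I_m => e i j)).
pose z j := P j - (x j)%:P.
pose G (b : {ffun 'I_m -> 'I_N}) (j : nat) := (g j + if insub j is Some k then b k : nat else 0)%N.
have GE b (j : 'I_m) : G b j = (g j + b j)%N by rewrite /G valK.
have -> : hasse {poly L} I J (fun i => (c i)%:P) e m g P =
    \sum_(b : {ffun 'I_m -> 'I_N}) (hasse L I J c e m (G b) x)%:P *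
      \prod_(j < m) (z j ^+ b j *+ 'C(g j + b j, g j)).
  rewrite /hasse; under [RHS]eq_bigr do rewrite rmorph_sum mulr_suml.
  rewrite exchange_big /=; apply: eq_bigr => i iJ.
  under eq_bigr => j _.
    rewrite (_ : P j = (x j)%:P + z j); last by rewrite addrC subrK.
    rewrite (taylor_monomial _ _ _ _ _ _ (eN _ _ iJ)); over.
  rewrite bigA_distr_bigA mulr_sumr; apply: eq_bigr => b _.
  rewrite rmorphM /= -mulrA; congr (_ * _).
  rewrite rmorph_prod -big_split /=; apply: eq_bigr => j _.
  by rewrite GE rmorphMn rmorphXn.
apply: (big_ind (fun p => ('X - s%:P) ^+ _ %| p)); rewrite ?dvdp0 //.
  by move=> p q; apply: dvdp_add.
move=> b _; have [lt|le] := ltnP (\sum_(j < m) G b j) M.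
  by rewrite x0 // polyC0 mul0r dvdp0.
have {le} le : (M - \sum_(j < m) g j <= \sum_(j < m) b j)%N.
  rewrite leq_subLR; apply: leq_trans le _.
  by rewrite -big_split /= leq_sum // => j _; rewrite GE.
apply: dvdp_mull; apply: dvdp_trans (dvdp_exp2l _ le) _.
rewrite expr_sum; apply: (big_ind2 (fun p q => p %| q)) => // [*|j _]; first exact: dvdp_mul.
rewrite -mulr_natr; apply: dvdp_mulr; apply: dvdp_exp2r.
exact: Pd.
Qed.

(** * Polynomials vanishing to high order on a finite set *)

Lemma underdetermined_system (L : fieldType) (A B : finType) (K : A -> B -> L) :
  (#|B| < #|A|)%N ->
  exists2 c : A -> L, exists a, c a != 0 & forall b, \sum_a c a * K a b = 0.
Proof.
move=> BA; pose Mx : 'M[L]_(#|A|, #|B|) := \matrix_(i, j) K (enum_val i) (enum_val j).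
have : kermx Mx != 0.
  rewrite -mxrank_eq0 mxrank_ker -lt0n subn_gt0.
  exact: leq_ltn_trans (rank_leq_col _) BA.
case/rowV0Pn => v /sub_kermxP vM v0; exists (fun a => v 0 (enum_rank a)).
  have [i vi] := rV0Pn v v0; exists (enum_val i); by rewrite enum_valK.
move=> b; have := congr1 (fun N : 'rV_ _ => N 0 (enum_rank b)) vM; rewrite !mxE => vb; rewrite -[RHS]vb.
rewrite (reindex (@enum_val A A)) /=; last first.
  exists enum_rank => [i _ | a _]; [exact: enum_valK | exact: enum_rankK].
by apply: eq_bigr => i _; rewrite !mxE enum_rankK enum_valK.
Qed.

Definition expo (m N : nat) (a : m.-tuple 'I_N) (j : nat) : nat := nth 0%N (map val a) j.

Lemma sum_expo (m N : nat) (a : m.-tuple 'I_N) :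
  (\sum_(j < m) expo m N a j = \sum_(i <- a) i)%N.
Proof.
rewrite big_tuple; apply: eq_bigr => j _.
by rewrite /expo (nth_map (tnth a j)) ?size_tuple // -tnth_nth.
Qed.

Lemma expo_inj (m N : nat) (a a' : m.-tuple 'I_N) :
  (forall j, (j < m)%N -> expo m N a j = expo m N a' j) -> a = a'.
Proof.
move=> eqa; apply/val_inj/(inj_map val_inj)/(@eq_from_nth _ 0%N).
  by rewrite !size_map !size_tuple.
by move=> j; rewrite size_map size_tuple; apply: eqa.
Qed.

Lemma eq_hasse (A : comNzRingType) (I : finType) (J : {set I}) (c : I -> A)
    (e : I -> nat -> nat) (m : nat) (b b' : nat -> nat) (x x' : nat -> A) :
  (forall j, (j < m)%N -> b j = b' j) -> (forall j, (j < m)%N -> x j = x' j) ->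
  hasse A I J c e m b x = hasse A I J c e m b' x'.
Proof.
move=> bb xx; apply: eq_bigr => i _; congr (_ * _).
by apply: eq_bigr => j _; rewrite bb ?xx.
Qed.

(** Dimension count: there are ['C(m + D, m)] monomials of degree at most [D], and vanishing to
    order [M] at one point imposes ['C(m + M.-1, m)] linear conditions. *)
Lemma exists_vanishing (L : fieldType) (X : finType) (p : X -> nat -> L) (m D M : nat) :
  (0 < M)%N -> (#|X| * 'C(m + M.-1, m) < 'C(m + D, m))%N ->
  exists2 c : m.-tuple 'I_D.+1 -> L,
    (exists a, c a != 0) /\ (forall a, c a != 0 -> (\sum_(j < m) expo m D.+1 a j <= D)%N)
    & forall x (b : nat -> nat), (\sum_(j < m) b j < M)%N ->
      hasse L _ [set a | c a != 0] c (expo m D.+1) m b (p x) = 0.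
Proof.
move=> M0; rewrite -!card_partial_ord_partitions.
set SD := [set t : m.-tuple 'I_D.+1 | _]; set SM := [set t : m.-tuple 'I_M.-1.+1 | _].
move=> lt.
pose K (a : {a | a \in SD}) (xb : X * {b | b \in SM}) :=
  \prod_(j < m) (p xb.1 j ^+ (expo _ _ (val a) j - expo _ _ (val xb.2) j)
     *+ 'C(expo _ _ (val a) j, expo _ _ (val xb.2) j)).
have [|c' [a0 ca0] c'K] := @underdetermined_system L _ _ K.
  by rewrite card_prod !card_sig.
(* Extending the solution by 0 outside [SD] builds the degree bound into the support of the
   coefficients. *)
exists (fun a => if insub a is Some a' then c' a' else 0).
  split; first by exists (val a0); rewrite valK.
  by move=> a; case: insubP => [u aD _ _|]; rewrite ?eqxx // sum_expo; move: aD; rewrite inE.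
move=> x b bM.
(* The conditions are indexed by tuples with entries below [M]; [b] agrees with such a tuple on the
   first [m] indices because its total is below [M]. *)
pose b' : m.-tuple 'I_M.-1.+1 := [tuple inord (b j) | j < m].
have bb j : (j < m)%N -> b j = expo _ _ b' j.
  move=> jm; rewrite /expo (nth_map ord0) ?size_tuple //.
  have := tnth_mktuple (fun j : 'I_m => inord (b j) : 'I_M.-1.+1) (Ordinal jm).
  rewrite (tnth_nth ord0) => -> /=; rewrite inordK // prednK //.
  by apply: leq_ltn_trans bM; rewrite (bigD1 (Ordinal jm)) //= leq_addr.
have b'M : b' \in SM.
  rewrite inE -sum_expo; under eq_bigr => j _ do rewrite -bb //.
  by rewrite -ltnS prednK.
rewrite (eq_hasse _ _ _ _ _ _ _ (expo _ _ b') _ (p x)) //.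
rewrite -[RHS](c'K (x, exist _ b' b'M)) /hasse.
rewrite big_mkcond /=.
transitivity (\sum_(a | a \in SD) (if insub a is Some a' then c' a' * K a' (x, exist _ b' b'M) else 0)).
  rewrite [RHS]big_mkcond; apply: eq_bigr => a _; rewrite inE.
  case: insubP => [u aD ua|/negPf ->]; last by rewrite eqxx.
  by rewrite aD; case: eqP => [->|_]; rewrite ?mul0r // /K /= ua.
rewrite (reindex_omap (fun u : {a | a \in SD} => val u) insub) /=; last first.
  by move=> a aD; rewrite insubT.
by apply: eq_big => [u|u _]; rewrite ?valK ?(valP u) ?eqxx.
Qed.

(** * Kakeya sets of planes *)

Lemma coef_mul_top (A : nzRingType) (f g : {poly A}) (k l : nat) :
  (size f <= k.+1)%N -> (size g <= l.+1)%N ->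
  (size (f * g)%R <= (k + l).+1)%N /\ (f * g)`_(k + l) = f`_k * g`_l.
Proof.
move=> fk gl; split.
  by apply: leq_trans (size_polyMleq _ _) _; move: (size f) (size g) fk gl => a b; lia.
rewrite coefM (bigD1 (inord k)) //= inordK ?ltnS ?leq_addr // addKn.
rewrite big1 ?addr0 // => i ik.
have [ki|ki|ki] := ltngtP i k.
- by rewrite [g`_ _]nth_default ?mulr0 //; apply: leq_trans gl _; lia.
- by rewrite [f`_i]nth_default ?mul0r //; apply: leq_trans fk _.
- by case/eqP: ik; apply/val_inj; rewrite /= ki inordK ?ltnS ?leq_addr.
Qed.

Lemma coef_exp_top (A : nzRingType) (f : {poly A}) (k r : nat) :
  (size f <= k.+1)%N ->
  (size (f ^+ r)%R <= (k * r).+1)%N /\ (f ^+ r)`_(k * r) = f`_k ^+ r.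
Proof.
move=> fk; elim: r => [|r [IH1 IH2]]; first by rewrite muln0 !expr0 size_poly1 coef1.
by rewrite mulnS !exprS -IH2; apply: coef_mul_top.
Qed.

Lemma coef_prod_top (A : comNzRingType) (m : nat) (f : 'I_m -> {poly A}) (k : 'I_m -> nat) :
  (forall j, size (f j) <= (k j).+1)%N ->
  (size (\prod_j f j)%R <= (\sum_j k j).+1)%N /\
  (\prod_j f j)`_(\sum_j k j) = \prod_j (f j)`_(k j).
Proof.
move=> fk.
pose K (p : {poly A}) (s : nat) (c : A) := (size p <= s.+1)%N /\ p`_s = c.
apply: (big_rec3 K) => [|j p s c _ [ps pc]]; rewrite /K.
  by rewrite size_poly1 coef1.
by rewrite -pc; apply: coef_mul_top.
Qed.

(** Along a curve of degree at most [q], a derivative of order [b] has formal degree [q] times [d]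
    minus the weight of [b]. Only monomials of full degree [d] reach it, so the coefficient there is
    the same derivative of the degree [d] form at the top coefficients of the curve. It may
    vanish. *)
Lemma hasse_curve_top (L : fieldType) (I : finType) (J : {set I}) (c : I -> L)
    (e : I -> nat -> nat) (m d q : nat) (b : nat -> nat) (P : nat -> {poly L}) :
  (0 < q)%N -> {in J, forall i, \sum_(j < m) e i j <= d}%N ->
  (forall j, (j < m)%N -> (size (P j) <= q.+1)%N) ->
  let h := hasse {poly L} I J (fun i => (c i)%:P) e m b P in
  let k := (q * (d - \sum_(j < m) b j))%N in
  (size h <= k.+1)%N /\
  h`_k = hasse L I [set i in J | (\sum_(j < m) e i j == d)%N] c e m b (fun j => (P j)`_q).
Proof.
move=> q0 ed Pq h k.
pose tm i := \prod_(j < m) (P j ^+ (e i j - b j) *+ 'C(e i j, b j)).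
have tmP i : i \in J -> (size (tm i) <= k.+1)%N /\ (tm i)`_k =
    if (\sum_(j < m) e i j == d)%N then
      \prod_(j < m) ((P j)`_q ^+ (e i j - b j) *+ 'C(e i j, b j)) else 0.
  (* If some [b j] exceeds [e i j], the binomial coefficient kills the whole term, so truncated
     subtraction does no harm. *)
  move=> iJ; have [/forallP be|/forallPn [j bj]] := boolP [forall j : 'I_m, (b j <= e i j)%N].
    pose ks (j : 'I_m) := (q * (e i j - b j))%N.
    have [|sz co] := coef_prod_top L m (fun j : 'I_m => P j ^+ (e i j - b j) *+ 'C(e i j, b j)) ks.
      move=> j; rewrite -mulr_natr -polyC1 -polyCMn mulrC mul_polyC.
      apply: leq_trans (size_scale_leq _ _) _.
      by have [] := coef_exp_top _ (P j) q (e i j - b j) (Pq _ (ltn_ord j)).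
    have ksE : (\sum_j ks j = q * (\sum_(j < m) e i j - \sum_(j < m) b j))%N.
      by rewrite -big_distrr /= sumnB.
    have be' : (\sum_(j < m) b j <= \sum_(j < m) e i j)%N by apply: leq_sum => j _.
    have le := ed _ iJ.
    have kk : (\sum_j ks j <= k)%N by rewrite ksE leq_mul2l leq_sub2r ?orbT.
    split; first exact: leq_trans sz _.
    have [E|E] := eqVneq (\sum_(j < m) e i j)%N d.
      rewrite /k -[in LHS]E -ksE co; apply: eq_bigr => j _.
      rewrite coefMn; congr (_ *+ _).
      by have [] := coef_exp_top _ (P j) q (e i j - b j) (Pq _ (ltn_ord j)).
    rewrite nth_default //; apply: leq_trans sz _.
    rewrite ksE /k ltn_pmul2l //.
    by move: be' le (E) => /=; set x := (\sum_(j < m) e i j)%N; set y := (\sum_(j < m) b j)%N; lia.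
  have C0 : 'C(e i j, b j) = 0%N by rewrite bin_small // ltnNge.
  rewrite /tm (bigD1 j) //= C0 mulr0n mul0r size_poly0 coef0; split=> //.
  by case: ifP => // _; rewrite (bigD1 j) //= C0 mulr0n mul0r.
split.
  apply: leq_trans (size_sum _ _ _) _; apply/bigmax_leqP => i iJ.
  rewrite mul_polyC; apply: leq_trans (size_scale_leq _ _) _.
  by case: (tmP i iJ).
rewrite /h /hasse coef_sum big_mkcond [RHS]big_mkcond; apply: eq_bigr => i _.
rewrite inE; case: ifP => //= iJ; rewrite coefCM.
have [_ ->] := tmP i iJ.
by case: ifP => //; rewrite mulr0.
Qed.

Lemma exprD_card (F : finFieldType) (L : fieldType) (iota : {rmorphism F -> L}) (x y : L) :
  (x + y) ^+ #|F| = x ^+ #|F| + y ^+ #|F|.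
Proof.
have [p p_pr pF] := finPcharP F.
have pL : p \in [pchar L] by apply: rmorph_pchar pF.
apply: exprDn_pchar; rewrite (eq_pnat _ (pcharf_eq pL)).
by rewrite [X in _.-nat X](card_pprimeChar pF) pnatX pnat_id.
Qed.

(** Bernoulli's inequality [1 - m / a <= (1 - 1 / a) ^ m], cleared of denominators. *)
Lemma bernoulli_nat (a m : nat) : (m <= a -> (a - m) * a ^ m <= a * a.-1 ^ m)%N.
Proof.
elim: m => [|m IHm] ma; first by rewrite subn0 !expn0.
have {}IHm := IHm (ltnW ma).
have [p pE] : {p | a = p.+1} by exists a.-1; rewrite prednK //; lia.
rewrite !expnS; move: IHm; rewrite pE /= => IHm.
have : ((p.+1 - m.+1) * p.+1 <= (p.+1 - m) * p)%N by move: ma; rewrite pE; nia.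
move: IHm; move: (p ^ m)%N (p.+1 ^ m)%N => X Y IHm h.
apply: (@leq_trans ((p.+1 - m) * p * Y)%N); first by rewrite mulnA leq_mul2r h orbT.
apply: (@leq_trans (p * (p.+1 * X))%N); last by rewrite mulnCA.
by rewrite [((_ - _) * p)%N]mulnC -mulnA leq_mul2l IHm orbT.
Qed.

(** The ratio of the binomials is the product over [i] of [(D + i) / (M.-1 + i)]. Each factor is at
    least [q (1 - 1 / (2 n))], and by Bernoulli the [m <= n] corrections cost at most a factor 2. *)
Lemma bin_ratio (n q m D M : nat) : (0 < n)%N -> (0 < M)%N -> (m <= n)%N ->
  (forall i, (0 < i <= m)%N -> (n.*2.-1 * (q * (M.-1 + i)) <= n.*2 * (D + i))%N) ->
  (q ^ m * 'C(m + M.-1, m) <= 2 * 'C(m + D, m))%N.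
Proof.
move=> n0 M0 mn H.
have step i : (i <= m)%N ->
    (n.*2.-1 ^ i * (q ^ i * 'C(i + M.-1, i)) <= n.*2 ^ i * 'C(i + D, i))%N.
  elim: i => [|i IHi] im; first by rewrite !bin0.
  have {}IHi := IHi (ltnW im); have Hi := H i.+1 im.
  rewrite -(leq_pmul2l (ltn0Sn i)) !expnS.
  have E N : (i.+1 * 'C(i.+1 + N, i.+1) = (N + i.+1) * 'C(i + N, i))%N.
    by rewrite -mul_bin_diag addSn /= addnC -addSnnS.
  move: {E} (E M.-1) (E D) Hi IHi.
  set c1 := 'C(i.+1 + M.-1, i.+1); set d1 := 'C(i.+1 + D, i.+1).
  set c0 := 'C(i + M.-1, i); set d0 := 'C(i + D, i).
  move: c1 d1 c0 d0 (n.*2.-1 ^ i)%N (n.*2 ^ i)%N (q ^ i)%N (M.-1 + i.+1)%N (D + i.+1)%N.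
  set a := n.*2.-1; clearbody a; move: n.*2 => b c1 d1 c0 d0 x z y s t E1 E2 Hi IHi.
  have -> : (i.+1 * (a * x * (q * y * c1)) = a * x * (q * y) * (i.+1 * c1))%N by lia.
  have -> : (i.+1 * (b * z * d1) = b * z * (i.+1 * d1))%N by lia.
  by rewrite E1 E2; have := leq_mul Hi IHi; lia.
have := step _ (leqnn m).
have B := bernoulli_nat n.*2 m ltac:(lia).
have P : (0 < n.*2 ^ m)%N by rewrite expn_gt0; lia.
have {}B : (n.*2 ^ m <= 2 * n.*2.-1 ^ m)%N.
  rewrite -(leq_pmul2l n0) mulnA muln2; apply: leq_trans B.
  by rewrite leq_mul2r; apply/orP; right; lia.
move: B P; move: (q ^ m * _)%N 'C(m + D, m) (n.*2 ^ m)%N (n.*2.-1 ^ m)%N => X Y a b B P S.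
rewrite -(leq_pmul2l P); apply: leq_trans (leq_mul B (leqnn X)) _.
by rewrite -mulnA [X in (_ <= X)%N]mulnCA leq_mul2l S.
Qed.

(** The condition on [w] makes 1 and [w] independent over [F]. Hence [x + w y] turns the points of a
    plane into distinct elements of [L], and a plane can be treated as a curve in one variable. *)
Lemma kakeya_planes_over (F : finFieldType) (L : fieldType) (iota : {rmorphism F -> L}) (w : L)
    (n m : nat) (U : {set 'rV[F]_m}) (Dir : {set 'M[F]_(2, m)}) :
  w ^+ #|F| != w -> (0 < n)%N -> (m <= n)%N -> (32 * n <= #|F|)%N ->
  (forall Y, Y \in Dir -> exists a : 'rV[F]_m,
     ((4 * n - 1) * #|F| ^ 2 <= 4 * n * #|[set u : 'rV[F]_2 | (a + u *m Y)%R \in U]|)%N) ->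
  (#|F| ^ (2 * m) <= 2 * #|Dir|)%N ->
  (#|F| ^ m <= 2 * #|U|)%N.
Proof.
move=> wq n0 mn; set q := #|F| => nq DirU Dir2; rewrite leqNgt; apply/negP => U2.
have q1 : (1 < q)%N by exact: finNzRing_gt1.
(* D / M is q (1 - O(1 / n)) and M is at least of order n^2, so that 'C(m + D, m) is at
   least q^m / 2 times 'C(m + M.-1, m): this leaves room for a polynomial of degree D
   vanishing to order M on U. *)
pose D := ((4 * n - 1) * q ^ 2)%N; pose M := (4 * n * q + 8 * n)%N.
have M0 : (0 < M)%N by rewrite /M; lia.
pose co (v : 'rV[F]_m) (j : nat) : L := if insub j is Some k then iota (v 0 k) else 0.
have coE v (k : 'I_m) : co v k = iota (v 0 k) by rewrite /co valK.
have bin : (#|{: {u | u \in U}}| * 'C(m + M.-1, m) < 'C(m + D, m))%N.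
  rewrite card_sig.
  have R : (q ^ m * 'C(m + M.-1, m) <= 2 * 'C(m + D, m))%N.
    apply: (bin_ratio n) => // i /andP[i0 im].
    rewrite /M /D -[(q ^ 2)%N]mulnn; move: (leq_trans im mn) nq n0 i0; clear.
    move: q => q; nia.
  have B0 : (0 < 'C(m + M.-1, m))%N by rewrite bin_gt0 leq_addr.
  rewrite -(ltn_pmul2l (ltn0Sn 1)) mulnA; apply: leq_trans R.
  by rewrite ltn_pmul2r.
have [c [ex_c cD] cU] := exists_vanishing L _ (fun u : {u | u \in U} => co (val u)) m D M M0 bin.
set e := expo m D.+1 in cD cU; set J := [set a | _] in cU.
pose d := (\max_(a in J) \sum_(j < m) e a j)%N.
have ed : {in J, forall a, (\sum_(j < m) e a j <= d)%N}.
  by move=> a aJ; rewrite /d (bigD1 a) //= leq_maxl.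
have [a1 a1J da1] : {a1 | a1 \in J & d = (\sum_(j < m) e a1 j)%N}.
  by apply: eq_bigmax_cond; apply/card_gt0P; have [a ca] := ex_c; exists a; rewrite inE.
have dD : (d <= D)%N by rewrite da1; apply: cD; move: a1J; rewrite inE.
(* Each point s = x + w y of F + w F satisfies s^q = x + w^q y, so x and y are the values
   at s of polynomials Xp and Yp of degree q. *)
pose kap := w ^+ q - w.
have kap0 : kap != 0 by rewrite subr_eq0.
pose el (z : F * F) := iota z.1 + w * iota z.2.
pose Yp : {poly L} := kap^-1 *: ('X^q - 'X).
pose Xp : {poly L} := 'X - w *: Yp.
have iq x : iota x ^+ q = iota x by rewrite -rmorphXn expf_card.
have elY z : Yp.[el z] = iota z.2.
  rewrite /Yp hornerZ hornerD hornerN hornerXn hornerX /el.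
  rewrite (exprD_card _ _ iota) exprMn !iq opprD addrACA subrr add0r -mulrBl mulrA.
  by rewrite mulVf ?mul1r.
have elX z : Xp.[el z] = iota z.1.
  by rewrite /Xp hornerD hornerN hornerX hornerZ elY addrK.
have el_inj : injective el.
  move=> z z' E; have := elX z; have := elY z; rewrite E elY elX.
  by case: z z' {E} => [x y] [x' y'] /= /fmorph_inj -> /fmorph_inj ->.
(* The coefficient of degree [q] in [x Xp + y Yp]. The top coefficients of the curve attached to [Y]
   therefore form a point of the grid with the [q ^ 2] nodes [tt z]. *)
pose tt (z : F * F) := kap^-1 * (iota z.2 - w * iota z.1).
have tt_inj : injective tt.
  move=> [x y] [x' y'] /(mulfI (invr_neq0 kap0)) /= E.
  have /el_inj[] : el (y, - x) = el (y', - x') by rewrite /el /= !rmorphN !mulrN.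
  by move=> -> /oppr_inj ->.
have sY : (size Yp <= q.+1)%N.
  apply: leq_trans (size_scale_leq _ _) _; apply: leq_trans (size_polyD _ _) _.
  by rewrite size_polyN size_polyXn size_polyX geq_max leqnn ltnS ltnW.
have sX : (size Xp <= q.+1)%N.
  apply: leq_trans (size_polyD _ _) _; rewrite size_polyN size_polyX geq_max.
  by rewrite (leq_trans (size_scale_leq _ _)) // ltnS ltnW.
have X1 : ('X : {poly L})`_q = 0 by rewrite coefX gtn_eqF.
have cY : Yp`_q = kap^-1 by rewrite coefZ coefB coefXn eqxx X1 subr0 mulr1.
have cX : Xp`_q = - (w * kap^-1) by rewrite coefB coefZ X1 cY sub0r.
(* The support of the leading form, whose multiplicities on this grid sum to at most
   [d q ^ (2 m) / q ^ 2]. *)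
pose Jt := [set a in J | (\sum_(j < m) e a j == d)%N].
have [||||w' w'P w'S] := schwartz_zippel_mult L _ tt _ c m tt_inj e Jt d.
- by exists a1; rewrite inE a1J da1 eqxx.
- by move=> a; rewrite !inE => /andP[].
- by move=> a a' _ _; apply: expo_inj.
- by move=> a; rewrite inE => /andP[/ed].
pose vY (Y : 'M[F]_(2, m)) : m.-tuple (F * F) := [tuple (Y 0 j, Y 1 j) | j < m].
have vYE Y (j : 'I_m) : point L _ tt (vY Y) j = tt (Y 0 j, Y 1 j).
  by rewrite /point (nth_map (tnth (vY Y) j)) ?size_tuple // -tnth_nth tnth_mktuple.
(* Were the multiplicity below [8 n], some derivative of order [B < 8 n] would be nonzero on the
   curve. It vanishes to order [M - B > 4 n q] at each of at least [(1 - 1 / (4 n)) q ^ 2] points,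
   hence has more than [(4 n - 1) q ^ 3 = q D] zeros, exceeding its degree. *)
have claim Y : Y \in Dir -> (8 * n <= w' (vY Y))%N.
  move=> YD; rewrite leqNgt; apply/negP => lt.
  have [b bw hb] := w'P (vY Y); have [a aU] := DirU _ YD.
  pose P (j : nat) : {poly L} := if insub j is Some k then
    (iota (a 0 k))%:P + (iota (Y 0 k) *: Xp + iota (Y 1 k) *: Yp) else 0.
  have PE (j : 'I_m) : P j = (iota (a 0 j))%:P + (iota (Y 0 j) *: Xp + iota (Y 1 j) *: Yp).
    by rewrite /P valK.
  have sP j : (j < m)%N -> (size (P j) <= q.+1)%N.
    move=> jm; rewrite (PE (Ordinal jm)).
    apply: leq_trans (size_polyD _ _) _; rewrite geq_max.
    rewrite (leq_trans (size_polyC_leq1 _)) //=.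
    apply: leq_trans (size_polyD _ _) _; rewrite geq_max.
    by rewrite (leq_trans (size_scale_leq _ Xp)) ?(leq_trans (size_scale_leq _ Yp)).
  have [sh ch] := hasse_curve_top L _ J c e m d q b P (ltnW q1) ed sP.
  set h := hasse _ _ _ _ _ _ _ _ in sh ch.
  have h0 : h != 0.
    apply: contraNneq hb => h0.
    rewrite (_ : hasse _ _ _ _ _ _ _ _ = hasse L _ Jt c e m b (fun j => (P j)`_q)).
      by rewrite -ch h0 coef0.
    apply: eq_hasse => // j jm.
    rewrite (vYE _ (Ordinal jm)) (PE (Ordinal jm)) coefD coefC gtn_eqF ?(ltnW q1) // add0r.
    rewrite coefD 2!coefZ cX cY /tt /= mulrBr mulrN [RHS]addrC; congr (_ - _).
      by rewrite mulrC.
    by rewrite mulrC mulrA [iota _ * w]mulrC.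
  pose good := [set u : 'rV[F]_2 | (a + u *m Y)%R \in U].
  pose ur (z : F * F) : 'rV[F]_2 := \row_i (if i == 0 then z.1 else z.2).
  pose mu (z : F * F) := if ur z \in good then (M - \sum_(j < m) b j)%N else 0%N.
  have : (\sum_z mu z < size h)%N.
    apply: (sum_root_mult_lt _ _ el) => // z; rewrite /mu; case: ifP => [zg|_]; last first.
      by rewrite expr0 dvd1p.
    rewrite inE in zg.
    apply: (@hasse_curve_dvdp L _ J c e m b (co (a + ur z *m Y))).
      by move=> b' b'M; apply: (cU (exist (fun u : 'rV[F]_m => is_true (u \in U)) _ zg)).
    move=> j jm; rewrite dvdp_XsubCl rootE hornerD hornerN hornerC subr_eq0.
    rewrite (PE (Ordinal jm)) -[j]/(nat_of_ord (Ordinal jm)) coE /=.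
    rewrite hornerD hornerC hornerD 2!hornerZ elX elY !mxE rmorphD /= !big_ord_recl big_ord0 addr0 !mxE /=.
    rewrite rmorphD !rmorphM /= [iota z.1 * _]mulrC [iota z.2 * _]mulrC.
    by rewrite (_ : lift _ _ = 1) //; apply/val_inj.
  have -> : (\sum_z mu z = #|good| * (M - \sum_(j < m) b j))%N.
    rewrite -big_mkcond sum_nat_const; congr (_ * _)%N.
    rewrite -[RHS](on_card_preimset (f := ur)).
      by apply: eq_card => z; rewrite [RHS]inE.
    exists (fun u : 'rV[F]_2 => (u 0 0, u 0 1)) => [[x y] _|u _]; first by rewrite /ur !mxE.
    by apply/rowP => i; rewrite mxE; case: ifP => [/eqP->|] //=; case: i => [[|[|]]] //= *; congr (u _ _); apply/val_inj.
  move=> /leq_trans-/(_ _ sh).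
  rewrite ltnS; apply/negP; rewrite -ltnNge.
  have b8 : (\sum_(j < m) b j < 8 * n)%N := leq_ltn_trans bw lt.
  move: aU b8 dD; rewrite -/good -/q /M /D; move: #|good| (\sum_(j < m) b j)%N => G B.
  clear -n0 q1; rewrite -mulnn.
  move=> h1 h2 h3.
  have h4 : (4 * n * q + 1 <= 4 * n * q + 8 * n - B)%N by lia.
  have h5 : (q * (d - B) <= q * ((4 * n - 1) * (q * q)))%N by rewrite leq_mul2l; apply/orP; right; lia.
  apply: leq_ltn_trans h5 _.
  have h6 : (q * ((4 * n - 1) * (q * q)) <= q * (4 * n * G))%N by rewrite leq_mul2l h1 orbT.
  apply: leq_ltn_trans h6 _.
  have G0 : (0 < G)%N by rewrite lt0n; apply: contraTneq h1 => ->; rewrite muln0 -ltnNge !muln_gt0; lia.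
  apply: (@leq_trans (G * (4 * n * q + 1))%N); first by nia.
  by rewrite leq_mul2l h4 orbT.
have vY_inj : injective vY.
  move=> Y Y' E; apply/matrixP => i j.
  have := congr1 (fun v => tnth v j) E; rewrite !tnth_mktuple => -[E0 E1].
  by case: i => [[|[|i]]] // i2; [move: E0 | move: E1]; congr (_ = _); congr (_ _ _); apply/val_inj.
have : (#|Dir| * (8 * n) <= \sum_v w' v)%N.
  rewrite -(card_imset _ vY_inj) -sum_nat_const.
  apply: leq_trans (_ : \sum_(v in vY @: Dir) w' v <= _)%N.
    by apply: leq_sum => v /imsetP[Y YD ->]; apply: claim.
  by rewrite [X in (_ <= X)%N](bigID (mem (vY @: Dir))) leq_addr.
move: w'S; rewrite -big_distrl /= card_prod -/q mulnn -expnM.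
move: Dir2 dD; rewrite -/q /D; move: #|Dir| (\sum_v w' v)%N => X W.
have : (0 < q ^ (2 * m))%N by rewrite expn_gt0 (ltnW q1).
have : (0 < q ^ 2)%N by rewrite expn_gt0 (ltnW q1).
move: (q ^ (2 * m))%N (q ^ 2)%N; clear -n0; move=> A Q Q0 A0 h1 h2 h3 h4.
have h5 : (4 * n * Q * A <= d * A)%N.
  apply: leq_trans h3; apply: leq_trans (leq_mul h4 (leqnn Q)).
  rewrite mulnAC leq_mul2r; apply/orP; right; nia.
rewrite leq_pmul2r // in h5.
have := leq_trans h5 h2; rewrite leq_pmul2r //; lia.
Qed.

(* The field of rational functions supplies an element outside the image of F. *)
Lemma kakeya_planes (F : finFieldType) (n m : nat) (U : {set 'rV[F]_m}) (Dir : {set 'M[F]_(2, m)}) :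
  (0 < n)%N -> (m <= n)%N -> (32 * n <= #|F|)%N ->
  (forall Y, Y \in Dir -> exists a : 'rV[F]_m,
     ((4 * n - 1) * #|F| ^ 2 <= 4 * n * #|[set u : 'rV[F]_2 | (a + u *m Y)%R \in U]|)%N) ->
  (#|F| ^ (2 * m) <= 2 * #|Dir|)%N ->
  (#|F| ^ m <= 2 * #|U|)%N.
Proof.
pose iota : {rmorphism F -> {fraction {poly F}}} := (@tofrac {poly F}) \o polyC.
apply: (@kakeya_planes_over F _ iota (tofrac 'X)).
rewrite -tofracXn tofrac_eq; apply/eqP => /(congr1 (fun p : {poly F} => size p)).
rewrite size_polyXn size_polyX => -[E].
by have := finNzRing_gt1 F; rewrite E.
Qed.

(** * Second moments *)

Lemma sum_fiber_card (X Z : finType) (S : {set X}) (f : X -> Z) :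
  (\sum_z #|[set x in S | f x == z]| = #|S|)%N.
Proof.
rewrite -sum1_card (partition_big f predT) //=; apply: eq_bigr => z _.
by rewrite -sum1_card; apply: eq_bigl => x; rewrite inE.
Qed.

Lemma sum_fiber_card_sqr (X Z : finType) (S : {set X}) (f : X -> Z) :
  (\sum_z #|[set x in S | f x == z]| ^ 2 = \sum_(x in S) \sum_(y in S) (f x == f y))%N.
Proof.
rewrite (partition_big f predT) //=; apply: eq_bigr => z _.
have E : #|[set x in S | f x == z]| = (\sum_(y in S) (z == f y))%N.
  rewrite -sum1_card big_mkcond [RHS]big_mkcond; apply: eq_bigr => y _.
  by rewrite inE eq_sym; case: (y \in S); case: (z == f y).
rewrite (eq_bigr (fun=> #|[set x in S | f x == z]|)) => [|x /andP[_ /eqP->]] //.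
by rewrite sum_nat_const -mulnn; congr (_ * _)%N; apply: eq_card => x; rewrite !inE.
Qed.

(** The sum of squares counts colliding pairs: the diagonal gives the first term, and each pair of
    distinct points collides for at most a fraction [1 / #|Z|] of the maps. *)
Lemma second_moment_hash (T X Z : finType) (Om : {set T}) (S : {set X}) (f : T -> X -> Z) :
  {in S &, forall x y, x != y -> #|[set P in Om | f P x == f P y]| * #|Z| <= #|Om|}%N ->
  (\sum_(P in Om) (\sum_z #|[set x in S | f P x == z]| ^ 2) * #|Z|
     <= #|Om| * (#|S| * #|Z| + #|S| ^ 2))%N.
Proof.
move=> H.
under eq_bigr => P _ do rewrite sum_fiber_card_sqr.
rewrite -big_distrl /= exchange_big /= big_distrl /=.
apply: (@leq_trans (\sum_(x in S) #|Om| * (#|Z| + #|S|))%N); last first.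
  by rewrite sum_nat_const mulnCA mulnDr mulnn.
apply: leq_sum => x xS; rewrite exchange_big big_distrl /= mulnDr.
rewrite (bigD1 x) //= leq_add //.
  by rewrite leq_mul2r (eq_bigr (fun=> 1%N)) ?sum1_card ?leqnn ?orbT // => P _; rewrite eqxx.
apply: (@leq_trans (\sum_(y in S) #|Om|)%N); last by rewrite sum_nat_const mulnC.
rewrite [X in (_ <= X)%N](bigD1 x) //=; apply: leq_trans (leq_addl _ _).
apply: leq_sum => y /andP[yS yx].
rewrite eq_sym in yx; apply: leq_trans (H _ _ xS yS yx).
rewrite leq_mul2r; apply/orP; right.
rewrite -sum1_card big_mkcond [X in (_ <= X)%N]big_mkcond; apply: leq_sum => P _.
by rewrite inE; case: (P \in Om) => //=; case: eqP.
Qed.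

(** By the second moment bound the variances, summed over [P], total at most [#|Om| * #|S|], and
    every deviating [z] contributes at least [t ^+ 2]. *)
Lemma chebyshev_hash (R : realFieldType) (T X Z : finType) (Om : {set T}) (S : {set X})
    (f : T -> X -> Z) (t : R) : (0 < #|Z|)%N -> 0 <= t ->
  {in S &, forall x y, x != y -> #|[set P in Om | f P x == f P y]| * #|Z| <= #|Om|}%N ->
  (\sum_(P in Om) #|[set z | (t <= `| #|[set x in S | f P x == z]|%:R - #|S|%:R / #|Z|%:R |)%R]|)%:R
    * t ^+ 2 <= #|Om|%:R * #|S|%:R :> R.
Proof.
move=> Z0 t0 H; have Zp : 0 < #|Z|%:R :> R by rewrite ltr0n.
pose w P z := #|[set x in S | f P x == z]|.
set mu := _ / _.
have var P : \sum_z ((w P z)%:R - mu) ^+ 2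
    = (\sum_z w P z ^ 2)%:R - #|S|%:R ^+ 2 / #|Z|%:R :> R.
  under [LHS]eq_bigr => z _ do rewrite sqrrB.
  rewrite big_split /= sumrB sumrMnl -mulr_suml -natr_sum sum_fiber_card.
  rewrite sumr_const /= cardT -cardE natr_sum; under [in RHS]eq_bigr do rewrite natrX.
  rewrite -addrA; congr (_ + _); rewrite /mu -mulr_natr -mulr_natr.
  by field; rewrite gt_eqF.
have cheb P : #|[set z | t <= `|(w P z)%:R - mu|]|%:R * t ^+ 2 <= \sum_z ((w P z)%:R - mu) ^+ 2.
  rewrite mulr_natl -sumr_const big_mkcond /=; apply: ler_sum => z _.
  rewrite inE; case: ifP => [tz|_]; last exact: sqr_ge0.
  by rewrite -[X in _ <= X]real_normK ?num_real // lerXn2r ?nnegrE.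
rewrite natr_sum mulr_suml; apply: le_trans (ler_sum _ (fun P _ => cheb P)) _.
under eq_bigr => P _ do rewrite var.
rewrite sumrB sumr_const -natr_sum lerBlDr -(ler_pM2r Zp).
have := second_moment_hash _ _ _ _ _ f H; rewrite -(ler_nat R) -big_distrl /= natrM => /le_trans; apply.
rewrite natrM natrD natrM natrX -mulr_natl.
rewrite le_eqVlt; apply/orP; left; apply/eqP; field.
by rewrite gt_eqF.
Qed.

(** * Projections of full rank *)

Lemma exists_dual_neq0 (F : fieldType) (n : nat) (z z' : 'rV[F]_n) :
  z != 0 -> z' != 0 -> exists v : 'cV[F]_n, (z *m v) 0 0 = 1 /\ (z' *m v) 0 0 != 0.
Proof.
move=> /rV0Pn[i zi] /rV0Pn[j zj].
pose E k : 'cV[F]_n := delta_mx k 0.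
have mE (x : 'rV[F]_n) k : (x *m E k) 0 0 = x 0 k by rewrite -colE mxE.
have sE (x : 'rV[F]_n) k (a : F) : (x *m (a *: E k)) 0 0 = a * x 0 k.
  by rewrite -scalemxAr [LHS]mxE mE.
have [zi'|zi'] := eqVneq (z' 0 i) 0; last first.
  by exists ((z 0 i)^-1 *: E i); rewrite !sE mulVf // mulf_neq0 ?invr_eq0.
have [zj'|zj'] := eqVneq (z 0 j) 0; last first.
  by exists ((z 0 j)^-1 *: E j); rewrite !sE mulVf // mulf_neq0 ?invr_eq0.
exists ((z 0 i)^-1 *: E i + E j); rewrite !mulmxDr.
rewrite [X in X = 1]mxE [X in X != 0]mxE !sE !mE.
by rewrite zi' zj' mulr0 addr0 add0r mulVf.
Qed.

(** The determinant is [s]; the explicit inverse is that of Sherman and Morrison. *)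
Lemma rank_one_unit (F : fieldType) (n : nat) (v : 'cV[F]_n) (d : 'rV[F]_n) (s : F) :
  d *m v = (s - 1)%:M -> s != 0 -> 1%:M + v *m d \in unitmx.
Proof.
move=> dv s0.
have : (1%:M + v *m d) *m (1%:M - s^-1 *: (v *m d)) = 1%:M.
  rewrite mulmxDl mul1mx mulmxBr mulmx1 -scalemxAr -mulmxA [d *m (v *m d)]mulmxA dv.
  rewrite mul_scalar_mx -scalemxAr scalerA.
  rewrite -[RHS]addr0 -addrA; congr (_ + _).
  rewrite -[X in _ + (X - _)]scale1r -scalerBl -scaleNr -scalerDl.
  by rewrite [X in X *: _](_ : _ = 0) ?scale0r //; field.
by case/mulmx1_unit.
Qed.

(** Take the rank-one perturbation [x + (x v) (z' - z)] with [z v = 1] and [z' v] nonzero. It moves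
    vectors along [z' - z], which lies in [V], so it preserves [V]. *)
Lemma unit_transitive_in (F : fieldType) (n p : nat) (V : 'M[F]_(p, n)) (z z' : 'rV[F]_n) :
  z != 0 -> z' != 0 -> (z <= V)%MS -> (z' <= V)%MS ->
  exists h : 'M[F]_n, [/\ h \in unitmx, z *m h = z'
    & forall x : 'rV[F]_n, (x *m h <= V)%MS = (x <= V)%MS].
Proof.
move=> z0 z0' zV zV'; have [v [zv zv']] := exists_dual_neq0 _ _ _ _ z0 z0'.
exists (1%:M + v *m (z' - z)); split.
- apply: (@rank_one_unit _ _ _ _ ((z' *m v) 0 0)) => //.
  apply/matrixP => i j; rewrite mulmxBl !mxE !ord1 eqxx mulr1n.
  by have := zv; rewrite !mxE => ->.
- rewrite mulmxDr mulmx1 mulmxA [z *m v]mx11_scalar zv mul1mx addrC subrK //.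
- move=> x; rewrite mulmxDr mulmx1 mulmxA [x *m v]mx11_scalar mul_scalar_mx.
  have dV : (((x *m v) 0 0) *: (z' - z) <= V)%MS.
    by rewrite scalemx_sub // addmx_sub // eqmx_opp.
  apply/idP/idP => xV; last exact: addmx_sub.
  by rewrite -[x](addrK (((x *m v) 0 0) *: (z' - z))) addmx_sub // eqmx_opp.
Qed.

Lemma unit_transitive_subspace (F : fieldType) (n k : nat) (M M' : 'M[F]_(k, n)) :
  \rank M = k -> \rank M' = k ->
  exists h : 'M[F]_n, h \in unitmx /\
    forall x : 'rV[F]_n, (x *m h <= M')%MS = (x <= M)%MS.
Proof.
have base (N : 'M[F]_(k, n)) : \rank N = k -> (N :=: (pid_mx k : 'M_(k, n)) *m row_ebase N)%MS.
  move=> rN; rewrite -{1}[N]mulmx_ebase rN -mulmxA.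
  by apply: eqmxMfull; rewrite row_full_unit col_ebase_unit.
move=> rM rM'; exists (invmx (row_ebase M) *m row_ebase M').
have u1 := row_ebase_unit M; have u2 := row_ebase_unit M'.
split; first by rewrite unitmx_mul unitmx_inv u1.
have fr N : N \in unitmx -> row_free N by rewrite row_free_unit.
move=> x; rewrite mulmxA (base _ rM') submxMfree ?fr //.
by rewrite (base _ rM) -{1}[pid_mx k](mulmxK u1) submxMfree // fr ?unitmx_inv.
Qed.

Lemma card_full_fiber (F : finFieldType) (n m : nat) (P : 'M[F]_(n, m)) (y : 'rV[F]_m) :
  \rank P = m -> (#|[set x : 'rV[F]_n | x *m P == y]| * #|F| ^ m = #|F| ^ n)%N.
Proof.
move=> rP; have fP : row_full P by rewrite /row_full rP.
have fib z : #|[set x : 'rV[F]_n | x *m P == z]| = #|[set x : 'rV[F]_n | x *m P == 0]|.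
  have zP : z *m pinvmx P *m P = z by rewrite mulmxKpV // submx_full.
  rewrite -[RHS](card_imset _ (addrI (z *m pinvmx P))); apply: eq_card => x; rewrite inE.
  apply/eqP/imsetP => [xz|[u]]; last by rewrite inE => /eqP u0 ->; rewrite mulmxDl zP u0 addr0.
  exists (x - z *m pinvmx P); last by rewrite addrC subrK.
  by rewrite inE mulmxBl zP xz subrr.
have := card_mx F 1 n; rewrite mul1n => <-.
rewrite -[RHS]sum1_card (partition_big (fun x => x *m P) predT) //=.
have := card_mx F 1 m; rewrite mul1n => <-.
rewrite fib mulnC -sum_nat_const; apply: eq_big => // z _.
by rewrite -(fib z) -sum1_card; apply: eq_bigl => x; rewrite inE.
Qed.

Definition full_rank_mx (F : finFieldType) (n m : nat) : {set 'M[F]_(n, m)} :=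
  [set P | \rank P == m].

(** This is the source of pairwise independence, since [P] identifies [x] and [y] exactly when it
    kills [x - y]. By symmetry all nonzero [z] in [V] are killed equally often; counting the pairs
    of [P] and a vector of [V] that it kills, and removing the zero vector, gives a frequency of at
    most [1 / Q]. *)
Lemma kernel_count_uniform (F : finFieldType) (n m p Q : nat) (V : 'M[F]_(p, n))
    (Om : {set 'M[F]_(n, m)}) : (0 < Q)%N ->
  (forall h P, h \in unitmx -> (forall x : 'rV[F]_n, (x *m h <= V)%MS = (x <= V)%MS) ->
     P \in Om -> h *m P \in Om) ->
  (forall P, P \in Om ->
     #|[set x : 'rV[F]_n | (x <= V)%MS && (x *m P == 0%R)]| * Q = #|[set x : 'rV[F]_n | (x <= V)%MS]|)%N ->
  forall z : 'rV[F]_n, z != 0 -> (z <= V)%MS ->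
  (#|[set P in Om | z *m P == 0%R]| * Q <= #|Om|)%N.
Proof.
move=> Q0 OmU OmK z z0 zV.
pose A := [set x : 'rV[F]_n | (x <= V)%MS].
pose N (x : 'rV[F]_n) := #|[set P in Om | x *m P == 0]|.
have Nle x y : x != 0 -> y != 0 -> (x <= V)%MS -> (y <= V)%MS -> (N x <= N y)%N.
  move=> x0 y0 xV yV; have [h [hu yh hV]] := unit_transitive_in _ _ _ _ _ _ y0 x0 yV xV.
  rewrite /N -(card_imset _ (can_inj (mulKmx hu))); apply: subset_leq_card.
  apply/fintype.subsetP => _ /imsetP[P + ->]; rewrite !inE => /andP[PO xP].
  by rewrite OmU //= mulmxA yh.
have NE x : x != 0 -> (x <= V)%MS -> N x = N z.
  by move=> x0 xV; apply/eqP; rewrite eqn_leq !Nle.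
have dc : (\sum_(x in A) N x * Q = #|Om| * #|A|)%N.
  transitivity (\sum_(P in Om) #|[set x : 'rV[F]_n | (x <= V)%MS && (x *m P == 0%R)]| * Q)%N.
    rewrite -!big_distrl /=; congr (_ * _)%N.
    under eq_bigr => x _ do rewrite /N -sum1_card big_mkcond.
    under [RHS]eq_bigr => P _ do rewrite -sum1_card big_mkcond.
    rewrite exchange_big [RHS]big_mkcond /=; apply: eq_bigr => P _.
    rewrite big_mkcond /=; case: ifP => PO; last first.
      by rewrite big1 // => x _; rewrite !inE PO if_same.
    by apply: eq_bigr => x _; rewrite !inE PO /=; case: ifP.
  by rewrite (eq_bigr (fun=> #|A|)) ?sum_nat_const // => P PO; rewrite OmK.
have A0 : 0 \in A by rewrite inE sub0mx.
have zA : z \in A by rewrite inE.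
rewrite (bigD1 0) //= (eq_bigr (fun=> N z * Q)%N) in dc; last first.
  by move=> x /andP[]; rewrite inE => xV x0; rewrite NE.
have cA : #|[pred x in A | x != 0]| = #|A|.-1.
  by rewrite (cardD1 0 A) A0 add1n /=; apply: eq_card => x; rewrite !inE andbC.
rewrite sum_nat_const cA in dc.
have N0 : N 0 = #|Om|.
  by apply: eq_card => P; rewrite inE mul0mx eqxx andbT.
have A2 : (1 < #|A|)%N.
  rewrite (cardD1 0 A) A0 (cardD1 z) !inE z0 zV /= //.
rewrite N0 in dc; rewrite -/(N z); move: dc A2 Q0; move: #|A| (N z) #|Om| => a b c.
case: a => [|[|a]] //= E _ Q0.
have : (a.+1 * (b * Q) <= a.+1 * c)%N by nia.
by rewrite leq_pmul2l.
Qed.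

(** Take [W] with the largest union of [D] among those satisfying the cost inequality. If [l]
    elements were uncovered, the hypothesis applied to them would give a [P] whose addition keeps
    the inequality and enlarges the union. *)
Lemma greedy_cover (T X Y : finType) (Om : {set T}) (U : T -> {set X}) (D : T -> {set Y})
    (K l : nat) :
  (forall C : {set Y}, (l <= #|C|)%N ->
     exists2 P, P \in Om & (K * #|U P| < #|D P :&: C|)%N) ->
  exists W : {set T}, [/\ W \subset Om,
    (K * #|\bigcup_(P in W) U P| <= #|\bigcup_(P in W) D P|)%N
    & (#|~: \bigcup_(P in W) D P| < l)%N].
Proof.
move=> H.
pose good (W : {set T}) := (W \subset Om) &&
  (K * #|(\bigcup_(P in W) U P)%SET| <= #|(\bigcup_(P in W) D P)%SET|)%N.
have g0 : good finset.set0 by rewrite /good finset.sub0set !big_set0 !cards0 muln0.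
case: (arg_maxnP (fun W : {set T} => #|(\bigcup_(P in W) D P)%SET|) g0) => W /andP[WO WK] max.
exists W; split=> //; rewrite ltnNge; apply/negP => /H[P PO lt].
have := max (P |: W)%SET.
have DE : #|(\bigcup_(Q in P |: W) D Q)%SET| =
    (#|(\bigcup_(Q in W) D Q)%SET| + #|(D P :&: ~: (\bigcup_(Q in W) D Q)%SET)%SET|)%N.
  rewrite finset.bigcup_setU big_set1 -(cardsID (\bigcup_(Q in W) D Q)%SET).
  set V := (\bigcup_(Q in W) D Q)%SET.
  by congr (_ + _)%N; apply: eq_card => x; rewrite !inE; case: (x \in D P); case: (x \in V).
have UE : (#|(\bigcup_(Q in P |: W) U Q)%SET| <= #|(\bigcup_(Q in W) U Q)%SET| + #|U P|)%N.
  by rewrite finset.bigcup_setU big_set1 addnC leq_card_setU.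
rewrite /good finset.subUset finset.sub1set PO WO /= DE.
move=> /(_ _)/Wrap[|].
  apply: leq_trans (leq_mul (leqnn K) UE) _; rewrite mulnDr; exact: leq_add WK (ltnW lt).
by rewrite leqNgt -[X in (X < _)%N]addn0 ltn_add2l (leq_ltn_trans _ lt).
Qed.

(** Dependent rows are [l y] and [y] for some scalar [l], or [y] and 0; the latter case is encoded
    by [None]. *)
Lemma card_not_full_rank2 (F : finFieldType) (m : nat) :
  (#|[set Y : 'M[F]_(2, m) | \rank Y != 2]| <= #|F|.+1 * #|F| ^ m)%N.
Proof.
pose g (p : option F * 'rV[F]_m) : 'M[F]_(2, m) := \matrix_(i, j)
  if p.1 is Some l then (if i == 0 then l * p.2 0 j else p.2 0 j)
  else (if i == 0 then p.2 0 j else 0).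
have <- : #|{: option F * 'rV[F]_m}| = (#|F|.+1 * #|F| ^ m)%N.
  by rewrite card_prod card_option card_mx mul1n.
rewrite -cardsT; apply: leq_trans (leq_imset_card g _); apply: subset_leq_card.
apply/fintype.subsetP => Y; rewrite inE => rY.
have : ~~ row_free Y by [].
rewrite -kermx_eq0 => /rowV0Pn[u /sub_kermxP uY u0].
have uE j : u 0 0 * Y 0 j + u 0 1 * Y 1 j = 0.
  have := congr1 (fun N : 'rV_m => N 0 j) uY; rewrite !mxE big_ord_recl big_ord1 => <-.
  by congr (_ + u _ _ * Y _ _); apply/val_inj.
have i01 (i : 'I_2) : i = 0 \/ i = 1.
  by case: i => [[|[|i]]] // i2; [left | right]; apply/val_inj.
have [u00|u00] := eqVneq (u 0 0) 0; apply/imsetP.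
  have u01 : u 0 1 != 0.
    apply: contraNneq u0 => u01; apply/eqP/rowP => i; rewrite mxE.
    by case: (i01 i) => ->.
  exists (None, row 0 Y) => //; apply/matrixP => i j; rewrite !mxE /=.
  case: (i01 i) => -> //=; have := uE j; rewrite u00 mul0r add0r => /eqP.
  by rewrite mulf_eq0 (negPf u01) => /eqP.
exists (Some (- (u 0 0)^-1 * u 0 1), row 1 Y) => //; apply/matrixP => i j; rewrite !mxE /=.
case: (i01 i) => -> //=; have := uE j => /eqP; rewrite addr_eq0 => /eqP E.
by apply: (mulfI u00); rewrite E !mulNr mulrN -!mulrA mulVKf.
Qed.

(** * Projections carrying a subspace onto a plane *)

Definition preim_span (F : finFieldType) (n m p : nat) (P : 'M[F]_(n, m)) (Y : 'M[F]_(p, m)) :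
  {set 'rV[F]_n} := [set x | (x *m P <= Y)%MS].

(** The preimage is the kernel of [P *m cokermx Y], which has rank [m - 2]. *)
Lemma preim_span_lin (F : finFieldType) (n m k : nat) (P : 'M[F]_(n, m)) (Y : 'M[F]_(2, m)) :
  (2 <= m)%N -> (k + m = n + 2)%N -> \rank P = m -> \rank Y = 2 ->
  preim_span F n m 2 P Y \in lin_subspaces F n k.
Proof.
move=> m2 kE rP rY; pose K := kermx (P *m cokermx Y).
have rK : \rank K = k.
  rewrite mxrank_ker; have fP : row_full P by rewrite /row_full rP.
  rewrite (eqmxMfull _ fP) mxrank_coker rY.
  have : (m <= n)%N by rewrite -rP rank_leq_row.
  lia.
have [B rB BK] : exists2 B : 'M[F]_(k, n), \rank B = k & (B :=: K)%MS.
  rewrite -rK; exists (row_base K); last exact: eq_row_base.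
  by rewrite eq_row_base.
apply/imsetP; exists B; first by rewrite inE rB.
apply/setP => x; rewrite !inE BK submxE.
by apply/idP/idP => [/eqP xP|/sub_kermxP xP]; [apply/sub_kermxP; rewrite mulmxA | rewrite -mulmxA; apply/eqP].
Qed.

(** For [Y] of rank 2, [2 <= m] and [k + m = n + 2], these sets partition the full-rank matrices as
    [A] runs over [lin_subspaces F n k]. They have equal sizes, so a proportion of subspaces becomes
    a proportion of projections. *)
Definition span_fiber (F : finFieldType) (n m : nat) (Y : 'M[F]_(2, m)) (A : {set 'rV[F]_n}) :
  {set 'M[F]_(n, m)} := [set P in full_rank_mx F n m | preim_span F n m 2 P Y == A].

Lemma card_row_space (F : finFieldType) (k n : nat) (M : 'M[F]_(k, n)) :
  \rank M = k -> #|[set v : 'rV[F]_n | (v <= M)%MS]| = (#|F| ^ k)%N.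
Proof.
move=> rM; have fM : row_free M by rewrite /row_free rM.
have := card_mx F 1 k; rewrite mul1n => <-.
rewrite -[RHS](card_imset _ (row_free_inj fM)); apply: eq_card => v; rewrite inE.
by apply/submxP/imsetP => [[D ->]|[D _ ->]]; exists D.
Qed.

Lemma rank_unitl (F : fieldType) (n m : nat) (h : 'M[F]_n) (P : 'M[F]_(n, m)) :
  h \in unitmx -> \rank (h *m P) = \rank P.
Proof. by rewrite -row_full_unit => fh; rewrite (eqmxMfull _ fh). Qed.

Lemma card_span_fiber (F : finFieldType) (n m k : nat) (Y : 'M[F]_(2, m)) (A A' : {set 'rV[F]_n}) :
  A \in lin_subspaces F n k -> A' \in lin_subspaces F n k ->
  #|span_fiber F n m Y A| = #|span_fiber F n m Y A'|.
Proof.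
suff le B B' : B \in lin_subspaces F n k -> B' \in lin_subspaces F n k ->
    (#|span_fiber F n m Y B'| <= #|span_fiber F n m Y B|)%N.
  by move=> hA hA'; apply/eqP; rewrite eqn_leq !le.
case/imsetP => M; rewrite inE => /eqP rM ->; case/imsetP => M'; rewrite inE => /eqP rM' ->.
have [h [hu hM]] := unit_transitive_subspace _ _ _ _ _ rM rM'.
rewrite -(card_imset _ (can_inj (mulKmx hu))); apply: subset_leq_card.
apply/fintype.subsetP => _ /imsetP[P + ->]; rewrite !inE => /andP[rP /eqP E].
rewrite rank_unitl // rP /=; apply/eqP/setP => x; rewrite !inE mulmxA -hM.
by move/setP/(_ (x *m h)): E; rewrite !inE.
Qed.

(** The stabiliser of [A] acts on the fibre, and each [P] in it has its whole kernel, of dimension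
    [n - m = k - 2], inside [A]; hence the frequency [1 / #|F| ^ 2]. *)
Lemma span_fiber_kernel (F : finFieldType) (n m k : nat) (Y : 'M[F]_(2, m)) (A : {set 'rV[F]_n}) :
  (k + m = n + 2)%N -> A \in lin_subspaces F n k ->
  forall z, z \in A -> z != 0 ->
  (#|[set P in span_fiber F n m Y A | z *m P == 0%R]| * #|F| ^ 2 <= #|span_fiber F n m Y A|)%N.
Proof.
move=> kE /imsetP[M]; rewrite inE => /eqP rM -> z; rewrite inE => zM z0.
have q0 : (0 < #|F|)%N by apply/card_gt0P; exists 0.
apply: (kernel_count_uniform _ _ _ _ _ M) => //; first by rewrite expn_gt0 q0.
  move=> h P hu hM; rewrite !inE => /andP[rP /eqP E]; rewrite rank_unitl // rP /=.
  apply/eqP/setP => x; rewrite !inE mulmxA -hM.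
  by move/setP/(_ (x *m h)): E; rewrite !inE.
move=> P; rewrite !inE => /andP[/eqP rP /eqP E]; rewrite (card_row_space _ _ _ _ rM).
have -> : #|[set x : 'rV[F]_n | (x <= M)%MS && (x *m P == 0)]| = #|[set x : 'rV[F]_n | x *m P == 0]|.
  apply: eq_card => x; rewrite !inE; case: eqP => [x0|]; rewrite ?andbF ?andbT //.
  by move/setP/(_ x): E; rewrite !inE x0 sub0mx.
have qm : (0 < #|F| ^ m)%N by rewrite expn_gt0 q0.
by apply/eqP; rewrite -(eqn_pmul2r qm) mulnAC (card_full_fiber _ _ _ _ _ rP) -!expnD kE.
Qed.

Lemma full_rank_kernel (F : finFieldType) (n m : nat) (z : 'rV[F]_n) : z != 0 ->
  (#|[set P in full_rank_mx F n m | z *m P == 0%R]| * #|F| ^ m <= #|full_rank_mx F n m|)%N.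
Proof.
move=> z0; have q0 : (0 < #|F|)%N by apply/card_gt0P; exists 0.
apply: (kernel_count_uniform _ _ _ _ _ 1%:M) => //; rewrite ?submx1 ?expn_gt0 ?q0 //.
  by move=> h P hu _; rewrite !inE rank_unitl.
move=> P; rewrite inE => /eqP rP; rewrite (card_row_space _ _ _ _ (mxrank1 _ _)).
rewrite -(card_full_fiber _ _ _ P 0 rP); congr (_ * _)%N.
by apply: eq_card => x; rewrite !inE submx1.
Qed.

(** * Deviant points and the planes rich in them *)

Definition deviant (R : realType) (F : finFieldType) (n m : nat) (S : {set 'rV[F]_n})
    (t mu : R) (P : 'M[F]_(n, m)) : {set 'rV[F]_m} :=
  [set y | t <= `| #|[set x in S | x *m P == y]|%:R - mu |].

Lemma sum_card_deviant (R : realType) (F : finFieldType) (n m : nat) (S : {set 'rV[F]_n}) (t : R) :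
  0 <= t ->
  (\sum_(P in full_rank_mx F n m) #|deviant R F n m S t (#|S|%:R / #|F|%:R ^+ m) P|)%:R
    * t ^+ 2 <= #|full_rank_mx F n m|%:R * #|S|%:R :> R.
Proof.
move=> t0; have cZ : #|{: 'rV[F]_m}| = (#|F| ^ m)%N by rewrite card_mx mul1n.
have q0 : (0 < #|F|)%N by apply/card_gt0P; exists 0.
have := @chebyshev_hash R _ _ _ (full_rank_mx F n m) S (fun P x => x *m P) t.
rewrite cZ natrX; apply=> //; first by rewrite expn_gt0 q0.
move=> x y _ _ xy; have := full_rank_kernel F n m (x - y); rewrite subr_eq0 => /(_ xy).
apply: leq_trans; rewrite leq_mul2r; apply/orP; right; apply: subset_leq_card.
by apply/fintype.subsetP => P; rewrite !inE mulmxBl subr_eq0.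
Qed.

(** The directions [Y] for which some translate of the plane lies in the deviant set up to a
    fraction [1 / (4 n)], as [kakeya_planes] requires. *)
Definition rich (R : realType) (F : finFieldType) (n m : nat) (S : {set 'rV[F]_n})
    (t mu : R) (P : 'M[F]_(n, m)) : {set 'M[F]_(2, m)} :=
  [set Y | (\rank Y == 2) && [exists b : 'rV[F]_m, ((4 * n - 1) * #|F| ^ 2 <=
    4 * n * #|[set u : 'rV[F]_2 | (b + u *m Y)%R \in deviant R F n m S t mu P]|)%N]].

Lemma deviation_bound (R : realFieldType) (n mu E tau : R) :
  0 <= n -> 0 <= mu -> 0 < E -> 0 < tau -> tau * E < `|mu - E| ->
  32 * n * (1 + tau) <= tau ^+ 2 * E -> 32 * n * mu <= (mu - E) ^+ 2.
Proof.
move=> n0 mu0 E0 tau0 dev big.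
have [le|gt] := lerP mu E.
  rewrite ler0_norm ?subr_le0 // in dev.
  have h1 : 32 * n * mu <= 32 * n * (1 + tau) * E.
    apply: ler_pM => //; first by rewrite mulr_ge0.
    by rewrite ler_peMr ?mulr_ge0 // lerDl ltW.
  apply: (le_trans h1); apply: (le_trans (ler_wpM2r (ltW E0) big)).
  rewrite -[X in _ <= X]sqrrN -mulrA -expr2 -exprMn lerXn2r ?nnegrE ?mulr_ge0 ?ltW //.
  by rewrite oppr_gt0 subr_lt0; nra.
rewrite gtr0_norm ?subr_gt0 // in dev.
set s := mu - E in dev *; have -> : mu = E + s by rewrite /s addrC subrK.
have s0 : 0 < s by apply: le_lt_trans dev; rewrite mulr_ge0 ?ltW.
have h : tau * (32 * n * (E + s)) <= tau * s ^+ 2.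
  have h1 : 32 * n * (tau * E + tau * s) <= 32 * n * (s + tau * s).
    by rewrite ler_wpM2l ?mulr_ge0 // lerD2r ltW.
  have h2 : 32 * n * (1 + tau) * s <= tau ^+ 2 * E * s by rewrite ler_wpM2r // ltW.
  have h3 : tau * s * (tau * E) <= tau * s * s by rewrite ler_wpM2l ?mulr_ge0 ?ltW.
  nra.
by rewrite ler_pM2l in h.
Qed.

(** Within the translate the fibres of [P] have mean size [mu], far from the global mean [E]. A poor
    [P] has at least [q ^ 2 / (4 n)] fibres that are far from [mu], writing [q] for [#|F|], and by
    Chebyshev and [deviation_bound] this happens for at most half of the span fibre. *)
Lemma few_poor_projections (R : realType) (F : finFieldType) (n m k : nat) (S A : {set 'rV[F]_n})
    (a : 'rV[F]_n) (Y : 'M[F]_(2, m)) (tau E : R) :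
  (0 < n)%N -> (k + m = n + 2)%N -> \rank Y = 2 -> A \in lin_subspaces F n k ->
  0 < E -> 0 < tau -> 32 * n%:R * (1 + tau) <= tau ^+ 2 * E ->
  tau * E < `| #|shift_flat F n A a :&: S|%:R / #|F|%:R ^+ 2 - E | ->
  (2 * #|[set P in span_fiber F n m Y A | Y \notin rich R F n m S (tau * E / 2) E P]|
     <= #|span_fiber F n m Y A|)%N.
Proof.
move=> n0 kE rY lA E0 tau0 big; set Sa := shift_flat F n A a :&: S; set mu := _ / _ => dev.
have q0 : (0 < #|F|)%N by apply/card_gt0P; exists 0.
have fY : row_free Y by rewrite /row_free rY.
have AB x y : x \in A -> y \in A -> x - y \in A.
  by case/imsetP: (lA) => M _ ->; rewrite !inE => xM yM; rewrite addmx_sub // eqmx_opp.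
have inSa x : (x \in Sa) = (x - a \in A) && (x \in S).
  rewrite inE; congr (_ && _); apply/imsetP/idP => [[v vA ->]|xA]; first by rewrite addrK.
  by exists (x - a); rewrite ?subrK.
pose f (P : 'M[F]_(n, m)) x : 'rV[F]_2 := (x - a) *m P *m pinvmx Y.
have fE P x : P \in span_fiber F n m Y A -> x - a \in A -> f P x *m Y = (x - a) *m P.
  by rewrite inE => /andP[_ /eqP <-]; rewrite inE => xY; rewrite /f mulmxKpV.
have cZ : #|{: 'rV[F]_2}| = (#|F| ^ 2)%N by rewrite card_mx mul1n.
(* A fibre size within [t] of [mu] is at distance at least [t > tau * E / 2] from [E], hence
   deviant. *)
pose t := `|mu - E| / 2.
have t0 : 0 < t by rewrite divr_gt0 //; apply: le_lt_trans dev; rewrite mulr_ge0 ?ltW.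
pose Z P := [set u | t <= `| #|[set x in Sa | f P x == u]|%:R - mu |].
have cheb : (\sum_(P in span_fiber F n m Y A) #|Z P|)%:R * t ^+ 2
    <= #|span_fiber F n m Y A|%:R * #|Sa|%:R :> R.
  have := @chebyshev_hash R _ _ _ (span_fiber F n m Y A) Sa f t.
  rewrite cZ natrX expn_gt0 q0; apply=> //; first exact: ltW.
  move=> x y; rewrite !inSa => /andP[xA _] /andP[yA _] xy.
  have xyA : x - y \in A by rewrite -[x](subrK a) -addrA -[a - y]opprB AB.
  have := span_fiber_kernel F n m k Y A kE lA (x - y) xyA; rewrite subr_eq0 => /(_ xy).
  apply: leq_trans; rewrite leq_mul2r; apply/orP; right; apply: subset_leq_card.
  apply/fintype.subsetP => P; rewrite !inE => /andP[PA /eqP E1]; rewrite PA /=.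
  have PA' : P \in span_fiber F n m Y A by rewrite !inE.
  have := fE P x PA' xA; rewrite E1 (fE P y PA' yA) !mulmxBl => /addIr ->.
  by rewrite subrr.
pose poor := [set P in span_fiber F n m Y A | Y \notin rich R F n m S (tau * E / 2) E P].
have poorP P : P \in poor -> (#|F| ^ 2 <= 4 * n * #|Z P|)%N.
  rewrite [_ \in poor]inE => /andP[PA]; rewrite inE rY eqxx /= negb_exists => /forallP/(_ (a *m P)).
  rewrite -ltnNge; set G := [set u | _] => ltG.
  have GZ : (#|F| ^ 2 <= #|G| + #|Z P|)%N.
    rewrite -cZ -(cardsC G) leq_add2l; apply: subset_leq_card.
    apply/fintype.subsetP => u; rewrite !inE -ltNge => dv.
    (* The fibre of [P] in all of [S] over a point of the translated plane already lies in the
       translate of [A], because [A] is the full preimage of the span of [Y]. *)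
    suff eqw : [set x in Sa | f P x == u] = [set x in S | x *m P == a *m P + u *m Y].
      rewrite eqw /t; set w := #|_|%:R in dv *.
      have h : `|mu - E| <= `|w - E| + `|w - mu|.
        have -> : mu - E = (mu - w) + (w - E) by rewrite addrA subrK.
        by rewrite [`|w - mu|]distrC addrC ler_normD.
      have : tau * E < `|mu - E| := dev.
      by move: h dv; lra.
    apply/setP => x; rewrite !inE; apply/idP/idP.
      move=> /andP[]; rewrite -[_ && _]/((x \in shift_flat F n A a) && (x \in S)) => + /eqP fu.
      have := inSa x; rewrite inE => -> /andP[xA ->] /=.
      by rewrite -fu (fE _ _ PA xA) mulmxBl addrC subrK.
    case/andP=> xS /eqP xP.
    have E1 : (x - a) *m P = u *m Y by rewrite mulmxBl xP addrC addKr.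
    have xA : x - a \in A.
      have := PA; rewrite inE => /andP[_ /eqP <-]; rewrite inE E1; exact: submxMl.
    have := inSa x; rewrite inE => ->; rewrite xA xS /=.
    by apply/eqP/(row_free_inj fY); rewrite fE.
  move: ltG GZ n0; move: #|G| #|Z P| (#|F| ^ 2)%N => g z Q; nia.
have sumZ : (#|poor| * #|F| ^ 2 <= 4 * n * \sum_(P in span_fiber F n m Y A) #|Z P|)%N.
  rewrite -sum_nat_const big_distrr /= [X in (_ <= X)%N](bigID (mem poor)) /=.
  apply: leq_trans (leq_addr _ _).
  rewrite [X in (_ <= X)%N](eq_bigl (mem poor)) => [|P /=].
    by apply: leq_sum => P /poorP.
  by rewrite [P \in poor]inE; case: (P \in span_fiber _ _ _ _ _).
have mu0 : 0 <= mu by rewrite divr_ge0 ?exprn_ge0.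
have db := deviation_bound R n%:R mu E tau (ler0n _ _) mu0 E0 tau0 dev big.
have tt : t ^+ 2 = (mu - E) ^+ 2 / 4.
  by rewrite /t expr_div_n -normrX ger0_norm ?sqr_ge0 // -natrX.
have t2 : 0 < t ^+ 2 by rewrite exprn_gt0.
have Q0 : 0 < #|F|%:R ^+ 2 :> R by rewrite exprn_gt0 // ltr0n.
have SE : #|Sa|%:R = mu * #|F|%:R ^+ 2 by rewrite /mu divfK ?gt_eqF.
rewrite -(ler_nat R) natrM -(ler_pM2r t2) -(ler_pM2r Q0).
have {}sumZ : #|poor|%:R * #|F|%:R ^+ 2
    <= 4 * n%:R * (\sum_(P in span_fiber F n m Y A) #|Z P|)%:R :> R.
  by rewrite -natrX -!natrM ler_nat.
rewrite SE in cheb; rewrite -/poor.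
move: (#|poor|%:R : R) (#|span_fiber F n m Y A|%:R : R) ((\sum_(P in _) _)%:R : R) (ler0n R #|span_fiber F n m Y A|) sumZ cheb.
rewrite tt in t2 *.
set Q := #|F|%:R ^+ 2 in Q0 *; set N := n%:R in db *.
move: ((mu - E) ^+ 2) db t2 => d db d0 p s z s0 sumZ cheb.
have N0 : 0 <= N := ler0n _ _.
have h1 : p * Q * (d / 4) <= 4 * N * (s * (mu * Q)).
  apply: le_trans (_ : 4 * N * z * (d / 4) <= _).
    by rewrite ler_wpM2r // ltW.
  by rewrite -[4 * N * z * _]mulrA ler_wpM2l ?mulr_ge0.
have h2 : (s * Q) * (32 * N * mu) <= (s * Q) * d.
  by rewrite ler_wpM2l // mulr_ge0 // ltW.
lra.
Qed.

Lemma sum_span_fiber (F : finFieldType) (n m k : nat) (Y : 'M[F]_(2, m))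
    (B : {set {set 'rV[F]_n}}) (A0 : {set 'rV[F]_n}) :
  B \subset lin_subspaces F n k -> A0 \in lin_subspaces F n k ->
  (\sum_(A in B) #|span_fiber F n m Y A| = #|B| * #|span_fiber F n m Y A0|)%N.
Proof.
move=> sB lA0; rewrite -sum_nat_const; apply: eq_bigr => A AB.
by apply: (card_span_fiber _ _ _ k) => //; apply: (fintype.subsetP sB).
Qed.

Lemma card_full_rank_span_fiber (F : finFieldType) (n m k : nat) (Y : 'M[F]_(2, m)) :
  (2 <= m)%N -> (k + m = n + 2)%N -> \rank Y = 2 ->
  #|full_rank_mx F n m| = (\sum_(A in lin_subspaces F n k) #|span_fiber F n m Y A|)%N.
Proof.
move=> m2 kE rY; rewrite -sum1_card.
rewrite (partition_big (fun P => preim_span F n m 2 P Y) (mem (lin_subspaces F n k))) /=; last first.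
  by move=> P; rewrite inE => /eqP rP; apply: preim_span_lin.
by apply: eq_bigr => A _; rewrite -sum1_card; apply: eq_bigl => P; rewrite !inE.
Qed.

(** Each bad [A] contributes at least half of its span fibre, and the span fibres are disjoint and
    equally large. *)
Lemma many_rich_projections (R : realType) (F : finFieldType) (n m k : nat) (S : {set 'rV[F]_n})
    (Y : 'M[F]_(2, m)) (Bad : {set {set 'rV[F]_n}}) (tau delta E : R) :
  (0 < n)%N -> (2 <= m)%N -> (k + m = n + 2)%N -> \rank Y = 2 ->
  0 < E -> 0 < tau -> 0 < delta -> 32 * n%:R * (1 + tau) <= tau ^+ 2 * E ->
  Bad \subset lin_subspaces F n k ->
  (forall A, A \in Bad -> exists a, tau * E <
     `| #|shift_flat F n A a :&: S|%:R / #|F|%:R ^+ 2 - E |) ->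
  delta * #|lin_subspaces F n k|%:R < #|Bad|%:R ->
  delta * #|full_rank_mx F n m|%:R <=
    2 * #|[set P in full_rank_mx F n m | Y \in rich R F n m S (tau * E / 2) E P]|%:R.
Proof.
move=> n0 m2 kE rY E0 tau0 delta0 big sB badP dB.
have [A0 A0B] : exists A, A \in Bad.
  apply/set0Pn; rewrite -cards_eq0 -lt0n -(ltr0n R); apply: le_lt_trans dB.
  by rewrite mulr_ge0 // ltW.
have lA0 := fintype.subsetP sB _ A0B.
pose N := #|span_fiber F n m Y A0|.
have FE : #|full_rank_mx F n m| = (#|lin_subspaces F n k| * N)%N.
  by rewrite (card_full_rank_span_fiber _ _ _ k Y) // (sum_span_fiber _ _ _ k _ _ A0).
set RS := [set P in _ | _].
have h : (#|Bad| * N <= 2 * #|RS|)%N.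
  rewrite -(sum_span_fiber _ _ _ k _ _ _ sB lA0).
  apply: (@leq_trans (\sum_(A in Bad) 2 * #|[set P in RS | preim_span F n m 2 P Y == A]|)%N).
    apply: leq_sum => A AB; have [a dev] := badP _ AB.
    have := few_poor_projections R F n m k S A a Y tau E n0 kE rY (fintype.subsetP sB _ AB) E0 tau0 big dev.
    rewrite -(cardsID [set P | Y \in rich R F n m S (tau * E / 2) E P] (span_fiber F n m Y A)).
    set B := [set P | Y \in _]; set G := span_fiber F n m Y A.
    have inB P : (P \in B) = (Y \in rich R F n m S (tau * E / 2) E P) by rewrite finset.in_set.
    have -> : #|[set P in G | Y \notin rich R F n m S (tau * E / 2) E P]| = #|(G :\: B)%SET|.
      by apply: eq_card => P; rewrite finset.in_setD finset.in_set inB andbC.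
    have -> : #|[set P in RS | preim_span F n m 2 P Y == A]| = #|(G :&: B)%SET|.
      by apply: eq_card => P; rewrite finset.in_setI inB finset.in_set [P \in RS]finset.in_set [P \in G]finset.in_set andbAC.
    by rewrite mul2n -addnn leq_add2r mul2n -addnn leq_add2l.
  rewrite -big_distrr /= leq_mul2l /= -[X in (_ <= X)%N]sum1_card.
  rewrite [X in (_ <= X)%N](partition_big (fun P => preim_span F n m 2 P Y) predT) //=.
  rewrite big_mkcond; apply: leq_sum => A _; case: ifP => // _.
  by rewrite -sum1_card; apply/eq_leq/eq_bigl => P; rewrite inE.
rewrite FE -natrM; apply: le_trans (_ : (#|Bad| * N)%:R <= _); last by rewrite ler_nat.
by rewrite !natrM mulrA ler_wpM2r // ltW.
Qed.

(** Averaging over [Om]: the sum of [#|D P :&: C|] is at least [p * #|Om| * #|C|], which exceeds [K]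
    times the sum of [#|U P|]. *)
Lemma exists_efficient_projection (R : realType) (T X Y : finType) (Om : {set T})
    (U : T -> {set X}) (D : T -> {set Y}) (C : {set Y}) (K : nat) (u p : R) :
  (0 < #|Om|)%N -> (\sum_(P in Om) #|U P|)%:R <= u * #|Om|%:R ->
  (forall y, y \in C -> p * #|Om|%:R <= #|[set P in Om | y \in D P]|%:R) ->
  K%:R * u < p * #|C|%:R ->
  exists2 P, P \in Om & (K * #|U P| < #|D P :&: C|)%N.
Proof.
move=> Om0 HU HD lt; apply: contrapT => nex.
have le P : P \in Om -> (#|D P :&: C| <= K * #|U P|)%N.
  by move=> PO; rewrite leqNgt; apply/negP => h; apply: nex; exists P.
have Op : 0 < #|Om|%:R :> R by rewrite ltr0n.
have dc : (\sum_(P in Om) #|D P :&: C| = \sum_(y in C) #|[set P in Om | y \in D P]|)%N.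
  under eq_bigr => P _ do rewrite -sum1_card big_mkcond.
  rewrite exchange_big [RHS]big_mkcond /=; apply: eq_bigr => y _.
  case: ifP => yC; last by rewrite big1 // => P _; rewrite inE yC andbF.
  rewrite -sum1_card [LHS]big_mkcond [RHS]big_mkcond /=; apply: eq_bigr => P _.
  by rewrite !inE yC andbT; case: (P \in Om).
have h1 : (\sum_(P in Om) #|D P :&: C| <= K * \sum_(P in Om) #|U P|)%N.
  by rewrite big_distrr; apply: leq_sum => P /le.
have h2 : p * #|Om|%:R * #|C|%:R <= (\sum_(P in Om) #|D P :&: C|)%:R.
  rewrite dc natr_sum mulr_natr -sumr_const.
  by apply: ler_sum => y yC; apply: HD.
have h3 : (\sum_(P in Om) #|D P :&: C|)%:R <= K%:R * (u * #|Om|%:R) :> R.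
  apply: (@le_trans _ _ (K * \sum_(P in Om) #|U P|)%:R); first by rewrite ler_nat.
  by rewrite natrM ler_wpM2l.
have := le_trans h2 h3; rewrite mulrA mulrAC ler_pM2r // leNgt => /negP; apply.
exact: lt.
Qed.

Lemma card_full_rank_mx_gt0 (F : finFieldType) (n m : nat) :
  (m <= n)%N -> (0 < #|full_rank_mx F n m|)%N.
Proof.
move=> mn; apply/card_gt0P; exists (pid_mx m).
by rewrite inE rank_pid_mx.
Qed.

(** * From too many unbalanced subspaces to a small Kakeya set *)

Theorem mainTheorem8 (R : realType) (F : finFieldType) (n : nat)
  (S : {set 'rV[F]_n}) (tau delta : R) (r : nat) :
  (5 <= n)%N ->
  (#|F| ^ 4 < #|S|)%N ->
  0 < tau -> 0 < delta -> delta < 1 ->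
  32 * Num.max (n%:R * (1 + tau) / (tau * delta) ^+ 2) n%:R <= #|F|%:R ->
  (4 <= r)%N -> (r <= n - 1)%N ->
  (#|F| ^ r < #|S|)%N -> (#|S| <= #|F| ^ r.+1)%N ->
  let k := (n - r + 3)%N in
  (1 - delta) * #|lin_subspaces F n k|%:R
    <= #|[set A in lin_subspaces F n k | `[< shift_balanced R F n k tau S A >]]|%:R.
Proof.
move=> n5 _ tau0 delta0 delta1 qbig r4 rn Sbig _; cbv zeta; set k := (n - r + 3)%N.
rewrite leNgt; apply/negP => contra.
set q := #|F| in qbig Sbig *.
(* With this [m] the mean fibre size [E] exceeds [q], and preimages of planes have dimension [k]. *)
pose m := (r - 1)%N.
have kE : (k + m = n + 2)%N by rewrite /k /m; lia.
have nk : (n - k = m - 2)%N by rewrite /k /m; lia.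
have m3 : (3 <= m)%N by rewrite /m; lia.
have mn : (m <= n)%N by rewrite /m; lia.
have n0 : (0 < n)%N by lia.
have q32 : (32 * n <= q)%N.
  rewrite -(ler_nat R) natrM; apply: le_trans qbig.
  by rewrite ler_wpM2l // le_max lexx orbT.
have q0 : (0 < q)%N by lia.
have q0R : 0 < q%:R :> R by rewrite ltr0n.
pose E : R := #|S|%:R / q%:R ^+ m.
have qm0 : 0 < q%:R ^+ m :> R by rewrite exprn_gt0.
have Eq : q%:R < E.
  rewrite /E ltr_pdivlMr // -exprS -natrX ltr_nat.
  by rewrite (_ : m.+1 = r) // /m; lia.
have E0 : 0 < E := lt_trans q0R Eq.
have taudelta : 32 * n%:R * (1 + tau) <= (tau * delta) ^+ 2 * q%:R.
  have td0 : 0 < (tau * delta) ^+ 2 by rewrite exprn_gt0 // mulr_gt0.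
  rewrite -ler_pdivrMl // mulrC; apply: le_trans qbig.
  by rewrite -!mulrA ler_wpM2l // le_max mulrA lexx.
have bigd : 32 * n%:R * (1 + tau) <= tau ^+ 2 * delta ^+ 2 * E.
  apply: le_trans taudelta _; rewrite exprMn ler_wpM2l ?(ltW Eq) //.
  by rewrite mulr_ge0 ?sqr_ge0.
have big : 32 * n%:R * (1 + tau) <= tau ^+ 2 * E.
  apply: le_trans bigd _; rewrite (ler_wpM2r (ltW E0)) // ler_piMr ?sqr_ge0 //.
  by rewrite exprn_ile1 // ltW.
pose Bad := [set A in lin_subspaces F n k | ~~ `[< shift_balanced R F n k tau S A >]].
have sB : Bad \subset lin_subspaces F n k.
  by apply/fintype.subsetP => A; rewrite inE => /andP[].
have dB : delta * #|lin_subspaces F n k|%:R < #|Bad|%:R.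
  have : #|lin_subspaces F n k| = (#|[set A in lin_subspaces F n k |
      `[< shift_balanced R F n k tau S A >]]| + #|Bad|)%N.
    rewrite -(cardsID [set A | `[< shift_balanced R F n k tau S A >]] (lin_subspaces F n k)).
    congr (_ + _)%N; apply: eq_card => A; rewrite !inE //.
    by rewrite andbC.
  move: contra => /[swap] ->; rewrite natrD; lra.
have badP A : A \in Bad -> exists a, tau * E <
     `| #|shift_flat F n A a :&: S|%:R / #|F|%:R ^+ 2 - E |.
  rewrite inE => /andP[_ /asboolPn/existsNP[a nb]]; exists a.
  rewrite ltNge; apply/negP => h; apply: nb; rewrite /balanced -/q.
  (* Since [n - k = m - 2], the expected size of a flat section is [q ^ 2] times the mean fibre
     size. *)
  have -> : Ek R F n k S = q%:R ^+ 2 * E.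
    rewrite /Ek /E -/q nk.
    have -> : q%:R ^+ m = q%:R ^+ 2 * q%:R ^+ (m - 2) :> R by rewrite -exprD subnKC // ltnW.
    by rewrite invfM mulrCA (mulrA (q%:R ^+ 2)) mulfV ?mul1r // expf_neq0 // gt_eqF.
  have Q0 : 0 < q%:R ^+ 2 :> R by rewrite exprn_gt0.
  rewrite -/q in h; move: h; set s := #|_|%:R => h.
  have -> : s - q%:R ^+ 2 * E = (s / q%:R ^+ 2 - E) * q%:R ^+ 2.
    by rewrite mulrBl divfK ?gt_eqF // [E * _]mulrC.
  by rewrite normrM (gtr0_norm Q0) [q%:R ^+ 2 * E]mulrC [tau * _]mulrA (ler_wpM2r (ltW Q0)).
pose t := tau * E / 2.
have t0 : 0 <= t by rewrite divr_ge0 // mulr_ge0 // ltW.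
pose Om := full_rank_mx F n m.
have Om0 : (0 < #|Om|)%N by apply: card_full_rank_mx_gt0.
(* Chebyshev bounds the average number of deviant points by [4 q ^ m / (tau ^ 2 E)]. From [n >= 5]
   comes [tau ^ 2 delta ^ 2 E >= 32 * 5 = 160], whence the 40. *)
have sumU : (\sum_(P in Om) #|deviant R F n m S t E P|)%:R
    <= (delta ^+ 2 * q%:R ^+ m / 40) * #|Om|%:R :> R.
  have := sum_card_deviant R F n m S t t0; rewrite -/q -/E -/Om.
  have -> : #|S|%:R = E * q%:R ^+ m by rewrite /E divfK // gt_eqF.
  set V := (_)%:R; have t2 : 0 < t ^+ 2.
    by rewrite exprn_gt0 // divr_gt0 // mulr_gt0.
  move=> h; rewrite -(ler_pM2r t2); apply: le_trans h _.
  have n5R : 5 <= n%:R :> R by rewrite ler_nat.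
  have h160 : 160 <= tau ^+ 2 * delta ^+ 2 * E.
    by apply: le_trans bigd; nra.
  rewrite [X in _ <= X](_ : _ = #|Om|%:R * ((tau ^+ 2 * delta ^+ 2 * E) / 160 * (E * q%:R ^+ m))).
    rewrite ler_wpM2l //; apply: ler_peMl; first exact: mulr_ge0 (ltW E0) (ltW qm0).
    by rewrite ler_pdivlMr // mul1r.
  by rewrite /t; field.
pose D := rich R F n m S t E.
have richP Y : \rank Y = 2 -> (delta / 2) * #|Om|%:R <= #|[set P in Om | Y \in D P]|%:R.
  move=> rY; have := many_rich_projections R F n m k S Y Bad tau delta E
    n0 (ltnW m3) kE rY E0 tau0 delta0 big sB badP dB.
  rewrite -/Om -/t; lra.
have cY : #|{: 'M[F]_(2, m)}| = (q ^ (2 * m))%N by rewrite card_mx.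
have q2m : (q ^ (2 * m) = q ^ m * q ^ m)%N by rewrite mul2n -addnn expnD.
(* The cost factor [5 * q ^ m] will force density at most 1/5. It is affordable because
   [5 delta ^ 2 / 40 <= (delta / 2) / 4], the 1/4 being the proportion of usable pairs [Y] in
   [C]. *)
have efficient (C : {set 'M[F]_(2, m)}) : ((q ^ (2 * m) %/ 2).+1 <= #|C|)%N ->
    exists2 P, P \in Om & (5 * q ^ m * #|deviant R F n m S t E P| < #|D P :&: C|)%N.
  rewrite ltn_divLR // => C2; pose X := [set Y : 'M[F]_(2, m) | \rank Y == 2].
  (* Over half of all pairs lie in [C], and since [m >= 3] at most a quarter of all pairs have rank
     below 2. *)
  have CX : (q ^ (2 * m) < 4 * #|C :&: X|)%N.
    have := card_not_full_rank2 F m; rewrite -/q.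
    have -> : #|[set Y : 'M[F]_(2, m) | \rank Y != 2]| = #|(~: X)%SET|.
      by apply: eq_card => Y; rewrite !inE.
    have := subset_leq_card (finset.subsetIr C (~: X)).
    have := cardsID X C; rewrite finset.setDE.
    have qm4 : (4 * q.+1 <= q ^ m)%N.
      apply: leq_trans (leq_pexp2l q0 m3).
      have q4 : (4 <= q)%N by apply: leq_trans q32; rewrite (leq_trans _ (leq_mul (leqnn 32) n0)).
      apply: leq_trans (leq_mul q4 (leq_mul q4 (leqnn q))).
      by rewrite mulnA -!mulnA leq_mul2l; move: q4; clear; case: q => // q; lia.
    have := leq_mul qm4 (leqnn (q ^ m)); rewrite -q2m.
    move: C2; move: #|C| #|C :&: X| #|C :&: ~: X| #|~: X| (q ^ (2 * m))%N (q ^ m)%N.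
    by clear; move=> c a b d x y h1 h2 h3 h4 h5; nia.
  have [||P PO lt] := @exists_efficient_projection R _ _ _ Om
    (deviant R F n m S t E) D (C :&: X) (5 * q ^ m) _ (delta / 2) Om0 sumU.
  - by move=> Y; rewrite inE => /andP[_]; rewrite inE => /eqP; apply: richP.
  - have : q%:R ^+ m * q%:R ^+ m < 4 * #|C :&: X|%:R :> R.
      by rewrite -!natrX -!natrM ltr_nat -q2m.
    rewrite natrM natrX => lt.
    have := ltr_pM2l delta0 (q%:R ^+ m * q%:R ^+ m) (4 * #|C :&: X|%:R); rewrite lt.
    have : delta ^+ 2 * (q%:R ^+ m * q%:R ^+ m) <= delta * (q%:R ^+ m * q%:R ^+ m) :> R.
      by rewrite ler_wpM2r ?mulr_ge0 ?(ltW qm0) // expr2 ler_piMr // ltW.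
    by move=> h1 h2; nra.
  exists P => //; apply: leq_trans lt _; apply: subset_leq_card.
  by rewrite finset.setIA finset.subsetIl.
have [W [WO WK Wl]] := greedy_cover _ _ _ Om (deviant R F n m S t E) D _ _ efficient.
set U' := (\bigcup_(P in W) deviant R F n m S t E P)%SET in WK.
set Dir := (\bigcup_(P in W) D P)%SET in WK Wl.
have Dir2 : (q ^ (2 * m) <= 2 * #|Dir|)%N.
  move: Wl; rewrite ltnS leq_divRL // -cY -(cardsC Dir).
  by rewrite muln2 -addnn mul2n -addnn leq_add2r leq_add2l.
have : (q ^ m <= 2 * #|U'|)%N.
  apply: (@kakeya_planes F n m U' Dir) => // Y /bigcupP[P PW]; rewrite inE => /andP[_ /existsP[b hb]].
  exists b; apply: leq_trans hb _; rewrite leq_mul2l; apply/orP; right.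
  apply: subset_leq_card; apply/fintype.subsetP => u; rewrite !inE => uD.
  by apply/bigcupP; exists P; rewrite ?inE.
(* Now [5 * q ^ m * #|U'| <= #|Dir| <= q ^ (2 m)] bounds the density of [U'] by 1/5, against the
   Kakeya lower bound 1/2. *)
have : (#|Dir| <= q ^ m * q ^ m)%N by rewrite -q2m -cY max_card.
have : (0 < q ^ m)%N by rewrite expn_gt0 q0.
move=> Q0 h1 h2; have := leq_trans WK h1.
rewrite -mulnA mulnCA leq_pmul2l //.
by move: Q0 h2; move: #|U'| (q ^ m)%N; clear; lia.
Qed.
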